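(* Let $A$ be an $(n-2)\times n$ integer matrix of rank $n-2$ whose row space over $\mathbb{Q}$ contains $(1,\dots,1)$, so that $X_A\subset\mathbb{P}^{n-1}$ is a projective toric variety of codimension $2$, let $B$ be a Gale dual of $A$ with rows $b_1,\dots,b_n$, all nonzero, and let $P=\mathrm{Conv}(A)$. Let $\beta\subset\alpha$ be proper faces of $P$ such that not all rows of $B_\beta$ are contained in the same relevant line, but all rows of $B_\alpha$ are contained in the same relevant line. Let $v\in\mathbb{Z}^2$ be a primitive vector of the relevant line containing the rows of $B_\alpha$, and let $\gamma_i=\det(v,b_i)$ for $i\in\mathfrak{I}_\beta$. Then $$\mu(\alpha,\beta)=\frac{\min\left(\sum_{i\in\mathfrak{I}_\beta:\ \gamma_i>0}|\gamma_i|,\ \sum_{i\in\mathfrak{I}_\beta:\ \gamma_i<0}|\gamma_i|\right)}{\gcd(\gamma_i)_{i\in\mathfrak{I}_\beta}}\qquad\text{and}\qquad i(\alpha,\beta)=\gcd(\gamma_i)_{i\in\mathfrak{I}_\beta}.$$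
   Context: Notation. The columns of $A$ are $a_1,\dots,a_n\in\mathbb{Z}^{d}$, $d=n-2$; $P=\mathrm{Conv}(A)$ is the convex hull of the columns. $X_A\subset\mathbb{P}^{n-1}$ is the closure of the image of the monomial map $t\mapsto(t^{a_1}:\cdots:t^{a_n})$, $t\in(\mathbb{C}^* )^d$. A Gale dual of $A$ is an $n\times 2$ integer matrix $B$ whose columns form a $\mathbb{Z}$-basis of the kernel of $A:\mathbb{Z}^n\to\mathbb{Z}^{d}$ (image of $B$ equals kernel of $A$). Its rows are $b_1,\dots,b_n\in\mathbb{Z}^2$. Faces are understood to be nonempty. For a face $\alpha$ of $P$: $A_\alpha$ is the collection of columns $a_i$ of $A$ lying on $\alpha$; $\mathfrak{I}_\alpha=\{i: a_i\notin\alpha\}$; $B_\alpha$ is the collection (or matrix) of rows $b_i$ with $i\in\mathfrak{I}_\alpha$. $\mathbb{Z}\alpha$ is the subgroup of $\mathbb{Z}^d$ generated by $A_\alpha$, and $\mathbb{R}\alpha$ is the linear subspace of $\mathbb{R}^d$ spanned by $\alpha$. A line through $0$ in $\mathbb{R}^2$ is a relevant line if it contains two of the rows $b_r,b_s$ of $B$ pointing in opposite directions. An integer vector is primitive if it is not a non-trivial integer multiple of another integer vector. For faces $\beta\subset\alpha$ of $P$: $i(\alpha,\beta)$ is the index $[\mathbb{Z}\alpha\cap\mathbb{R}\beta:\mathbb{Z}\beta]$. The relative normalized subdiagram volume is $$\mu(\alpha,\beta)=\mathrm{Vol}(\mathrm{Conv}(A_\alpha/\beta))-\mathrm{Vol}(\mathrm{Conv}((A_\alpha/\beta)\setminus\{0\})),$$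 where $A_\alpha/\beta$ is the image of $A_\alpha$ in the quotient lattice $\mathbb{Z}\alpha/(\mathbb{Z}\alpha\cap\mathbb{R}\beta)$, which has rank $\dim\alpha-\dim\beta$, and $\mathrm{Vol}$ is the $(\dim\alpha-\dim\beta)$-dimensional volume normalized with respect to this quotient lattice (a unimodular simplex has volume $1$; the volume of a lower-dimensional or empty polytope is $0$, while a point in rank $0$ has volume $1$). *)

(* Defs.v *)
From HB Require Import structures.
From mathcomp Require Import all_boot all_order all_algebra finmap.
From mathcomp Require Import all_classical all_reals all_analysis.

Set Implicit Arguments.
Unset Strict Implicit.
Unset Printing Implicit Defensive.

Import Order.TTheory GRing.Theory Num.Theory.

Local Open Scope classical_set_scope.
Local Open Scope ring_scope.

Section Hulls.
Context {R : realType} {V : lmodType R}.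

Definition conv_hull (S : set V) : set V :=
  smallest (fun C : set (convex_lmodType V) => convex_set C) S.

Definition lin_span (S : set V) : set V :=
  smallest (fun W : set V =>
    W 0 /\ forall (c : R) x y, W x -> W y -> W (c *: x + y)) S.

Definition subgroup_gen (S : set V) : set V :=
  smallest (fun G : set V => G 0 /\ forall x y, G x -> G y -> G (x - y)) S.

(* The index [G : H] for a subgroup H of G; it is 0 when there are
   infinitely many cosets. *)
Definition subgroup_index (G H : set V) : nat :=
  #|` fset_set [set [set (x + h)%R | h in H] | x in G]%classic |%fset.

End Hulls.

(* Lebesgue volume in R^k by slicing along the first coordinate: on Borel sets
   this is the k-fold product of the Lebesgue measure of R, the integral being
   the one that defines the product measure m1 \x m2 of the library.
   R^0 is a point of volume 1. *)
Fixpoint lebesgue_volume {R : realType} (k : nat) : set 'cV[R]_k -> \bar R :=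
  match k with
  | 0%N => fun S => ((0 : 'cV[R]_0) \in S)%:R%:E
  | k'.+1 => fun S =>
      (\int[@lebesgue_measure R]_t
         lebesgue_volume [set y : 'cV[R]_k' | S (col_mx (t%:M : 'cV[R]_1) y)])%E
  end.

(* Normalized with respect to Z^k: a unimodular simplex has volume 1. *)
Definition normalized_volume {R : realType} (k : nat) (S : set 'cV[R]_k) : \bar R :=
  ((k`!)%:R%:E * lebesgue_volume S)%E.

Section Polytopes.
Context {R : realType} {d n : nat}.
Implicit Types (A : 'M[int]_(d, n)) (F alpha beta : set 'cV[R]_d).

Definition column A (i : 'I_n) : 'cV[R]_d := map_mx intr (col i A).

Definition polytope A : set 'cV[R]_d := conv_hull (range (column A)).

(* Nonempty faces; u = 0 gives the whole polytope. *)
Definition is_face (P F : set 'cV[R]_d) : Prop :=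
  F !=set0 /\
  exists (u : 'rV[R]_d) (c : R),
    (forall x, P x -> (u *m x) 0 0 <= c) /\
    F = [set x | P x /\ (u *m x) 0 0 = c].

Definition is_proper_face (P F : set 'cV[R]_d) : Prop :=
  is_face P F /\ F <> P.

Definition columns_on A F : set 'cV[R]_d := range (column A) `&` F.

Definition indices_off A F : {set 'I_n} := [set i | column A i \notin F]%SET.

Definition lattice_of A F : set 'cV[R]_d := subgroup_gen (columns_on A F).

Definition face_index A alpha beta : nat :=
  subgroup_index (lattice_of A alpha `&` lin_span beta) (lattice_of A beta).

(* M identifies the quotient lattice L / (L `&` W) with Z^k, k being its rank.
   L need not be saturated in Z^d, so M is not required to be integral. *)
Definition quotient_coords (L W : set 'cV[R]_d) (k : nat) (M : 'M[R]_(k, d)) : Prop :=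
  [set M *m x | x in L] = range (fun z : 'cV[int]_k => map_mx intr z : 'cV[R]_k) /\
  forall x, L x -> (M *m x = 0 <-> W x).

(* The value does not depend on the coordinates chosen: two choices differ by
   an element of GL_k(Z). *)
Definition subdiagram_volume A alpha beta : \bar R :=
  let: existT k M :=
    xget (existT (fun k => 'M[R]_(k, d)) 0%N 0)
      [set kM | quotient_coords (lattice_of A alpha) (lin_span beta) (projT2 kM)] in
  let S := [set M *m a | a in columns_on A alpha] in
  (normalized_volume (conv_hull S) -
   normalized_volume (conv_hull (S `\ 0%R)))%E.

End Polytopes.

Section GaleDual.
Context {d n : nat}.

Definition gale_dual (A : 'M[int]_(d, n)) (B : 'M[int]_(n, 2)) : Prop :=
  A *m B = 0 /\
  forall x : 'cV[int]_n, A *m x = 0 -> exists! y : 'cV[int]_2, x = B *m y.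

Context {R : realType}.
Implicit Types (B : 'M[int]_(n, 2)) (l : set 'rV[R]_2).

Definition gale_row B (i : 'I_n) : 'rV[R]_2 := map_mx intr (row i B).

Definition line_through0 l : Prop :=
  exists2 u : 'rV[R]_2, u != 0 & l = range (fun c : R => c *: u).

Definition relevant_line B l : Prop :=
  line_through0 l /\
  exists r s : 'I_n,
    [/\ l (gale_row B r), l (gale_row B s), gale_row B s != 0 &
        exists2 c : R, 0 < c & gale_row B r = - (c *: gale_row B s)].

Definition rows_in B (I : {set 'I_n}) l : Prop :=
  forall i, i \in I -> l (gale_row B i).

Definition gale_det (v : 'rV[int]_2) B (i : 'I_n) : int :=
  \det (col_mx v (row i B) : 'M[int]_2).

End GaleDual.

Definition primitive_vector (m : nat) (v : 'rV[int]_m) : Prop :=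
  forall (c : int) (w : 'rV[int]_m), v = c *: w -> c = 1 \/ c = - 1.

(* Main.v *)
Require Import Defs.
From HB Require Import structures.
From mathcomp Require Import all_boot all_order all_algebra finmap.
From mathcomp Require Import all_classical all_reals all_analysis.
From mathcomp Require Import measurable_realfun ring.

Set Implicit Arguments.
Unset Strict Implicit.
Unset Printing Implicit Defensive.

Import Order.TTheory GRing.Theory Num.Theory.
Import numFieldNormedType.Exports.

Local Open Scope classical_set_scope.
Local Open Scope ring_scope.

(** Everything is read off from the relations among the columns of [A]. By Gale
    duality these relations are the vectors [B *m y], and such a relation only
    involves columns on [alpha] when [y] is orthogonal to the rows of [B] off
    [alpha]. These rows span the line of [v], so the relations on
    [alpha] are the multiples of one vector, whose entries are the determinants
    [gamma i] (lemmas [int_relation] and [real_relation]). The rows off [beta] do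
    not all lie on the line, so [gamma] does not vanish identically off [beta], and
    because a supporting functional of [beta] pairs to zero with it, it takes both
    signs there ([face_relation_signs]).

    Write [gamma = g c] off [beta], with [c] primitive. Modulo the columns on [beta],
    the lattice of [alpha] is a free group divided by the single element [g c].
    Its torsion is cyclic of order [g], generated by the class of the combination
    of columns with coefficients [c]; this is the index ([face_index_gcd]).
    Its torsion-free quotient is a lattice of rank [k] generated by [k + 1] vectors
    whose only relation is [c]: a circuit. Leaving out the [i]-th generator yields
    [k] vectors of determinant [c i] up to sign ([circuit_minors]).

    It remains to compare the pyramid with apex 0 over a circuit with the convex
    hull of the circuit. Suppose that [c] has nonnegative total. Adding a multiple of
    [c] to the coefficients of a point does not move the point; subtracting as much
    as nonnegativity allows cuts the pyramid into simplices, one for each positive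
    entry ([pyramid_cells]), and adding as much as possible cuts the part
    of the pyramid that is not in the hull into simplices, one for each negative
    entry ([pyramid_hull_cells]). The latter have total normalized volume the sum of
    the absolute values of the negative entries, which is the smaller of the two sums.

    The volume is defined by iterated slicing, so the formula for the volume of a
    simplex has to be derived from a linear change of variables
    ([volume_linear_preimage]). Maps compatible with slicing are dealt
    with by one-dimensional integration and induction, and Tonelli's theorem allows
    the first two coordinates to be exchanged; these maps generate the linear group. *)

(** * Measurability of the slice volume *)

Local Notation RM R := (measurableTypeR R).

Definition col_of_tuple (R : realType) (k : nat) (t : k.-tuple (RM R)) : 'cV[R]_k :=
  \col_i tnth t i.

(** Columns are measured through tuples: these carry the product sigma-algebra,
    for which a map is measurable as soon as its coordinates are, and
    prepending an entry to a tuple is stacking a scalar on a column. *)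
Definition borel (R : realType) (k : nat) (S : set 'cV[R]_k) : Prop :=
  measurable (@col_of_tuple R k @^-1` S).

Section VolumeMeasurability.
Context {R : realType}.

Lemma col_of_tuple_cons k (t : RM R) (u : k.-tuple (RM R)) :
  col_of_tuple [tuple of t :: u] = col_mx (t%:M : 'cV[R]_1) (col_of_tuple u).
Proof.
apply/matrixP => i j; rewrite !mxE.
case: (@split_ordP 1 k i) => i' ->; rewrite ?ord1 ?mxE /=.
  by rewrite (tnth_nth 0) /= ?mulr1n.
by rewrite !(tnth_nth 0).
Qed.

Lemma borel_preimage d (T : measurableType d) k (f : T -> 'cV[R]_k)
    (S : set 'cV[R]_k) :
  (forall i, measurable_fun setT (fun x => f x i 0 : RM R)) ->
  borel S -> measurable (f @^-1` S).
Proof.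
move=> mf mS.
pose g x : k.-tuple (RM R) := [tuple f x i 0 | i < k].
have mg : measurable_fun setT g.
  apply/measurable_fun_tnthP => i.
  by apply: eq_measurable_fun (mf i) => x _ /=; rewrite tnth_mktuple.
have -> : f = @col_of_tuple R k \o g.
  by apply/funext => x; apply/matrixP => i j; rewrite ord1 !mxE tnth_mktuple.
by rewrite comp_preimage -[X in measurable X]setTI; exact: mg.
Qed.

Lemma measurable_col_of_tuple k i :
  measurable_fun setT (fun t : k.-tuple (RM R) => col_of_tuple t i 0 : RM R).
Proof. by under eq_fun do rewrite mxE; exact: measurable_tnth. Qed.

Lemma borel_map k l (f : 'cV[R]_k -> 'cV[R]_l) (S : set 'cV[R]_l) :
  (forall i, measurable_fun setT
     (fun t : k.-tuple (RM R) => f (col_of_tuple t) i 0 : RM R)) ->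
  borel S -> borel (f @^-1` S).
Proof. by move=> mf mS; rewrite /borel -comp_preimage; exact: borel_preimage. Qed.

Lemma lebesgue_volume_ge0 k (S : set 'cV[R]_k) : (0 <= lebesgue_volume S)%E.
Proof.
elim: k S => [|k IH] S /=; first by rewrite lee_fin.
by apply: integral_ge0 => t _; exact: IH.
Qed.

(** The parameter [x] is what lets the induction on [k] run: slicing moves the
    first coordinate into the parameter, where the induction hypothesis sees
    it, and Tonelli's theorem integrates it out again. *)
Lemma lebesgue_volume_measurable k d (T : measurableType d)
    (S : set (T * 'cV[R]_k)) :
  measurable [set p : T * k.-tuple (RM R) | S (p.1, col_of_tuple p.2)] ->
  measurable_fun setT ((fun x => lebesgue_volume [set y | S (x, y)]) : T -> \bar R).
Proof.
elim: k d T S => [|k IH] d T S mS /=.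
  have -> : (fun x => ((0 \in [set y | S (x, y)])%:R)%:E)
      = EFin \o (\1_[set x | S (x, 0)] : T -> R).
    by apply/funext => x /=; rewrite indicE; congr (_%:R%:E); apply/idP/idP; rewrite !inE.
  apply/measurable_EFinP/measurable_indic.
  pose g (x : T) : T * 0.-tuple (RM R) := (x, [tuple]).
  have mg : measurable_fun setT g by exact: measurable_fun_pair.
  have -> : [set x | S (x, 0)] = setT `&` g @^-1` [set p | S (p.1, col_of_tuple p.2)].
    by rewrite setTI; apply/seteqP; split => x /=; rewrite flatmx0.
  exact: mg.
pose S' : set ((T * RM R) * 'cV[R]_k) :=
  [set p | S (p.1.1, col_mx (p.1.2%:M : 'cV[R]_1) p.2)].
have mS' : measurable [set p : (T * RM R) * k.-tuple (RM R) | S' (p.1, col_of_tuple p.2)].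
  pose g (p : (T * RM R) * k.-tuple (RM R)) : T * k.+1.-tuple (RM R) :=
    (p.1.1, [tuple of p.1.2 :: p.2]).
  have mg : measurable_fun setT g.
    apply: measurable_fun_pair; first exact: measurableT_comp.
    by apply: measurable_cons => //; exact: measurableT_comp.
  have -> : [set p | S' (p.1, col_of_tuple p.2)]
      = setT `&` g @^-1` [set p | S (p.1, col_of_tuple p.2)].
    by rewrite setTI; apply/seteqP; split => p; rewrite /S' /= col_of_tuple_cons.
  exact: mg.
have /= mF := IH _ _ _ mS'.
exact: (@measurable_fun_fubini_tonelli_F _ _ _ _ _ (@lebesgue_measure R)
  (fun p => lebesgue_volume [set y | S' (p, y)]) mF (fun=> lebesgue_volume_ge0 _)).
Qed.

Definition slice k (S : set 'cV[R]_(1 + k)) (t : R) : set 'cV[R]_k :=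
  [set y | S (col_mx (t%:M : 'cV[R]_1) y)].

Lemma volumeS k (S : set 'cV[R]_(1 + k)) :
  @lebesgue_volume R k.+1 S = (\int[@lebesgue_measure R]_t lebesgue_volume (slice S t))%E.
Proof. by []. Qed.

Lemma borel_slice2 k (S : set 'cV[R]_(1 + k)) : borel S ->
  measurable [set p : RM R * k.-tuple (RM R) | slice S p.1 (col_of_tuple p.2)].
Proof.
move=> mS; pose g (p : RM R * k.-tuple (RM R)) := [tuple of p.1 :: p.2].
have mg : measurable_fun setT g by exact: measurable_cons.
have -> : [set p : RM R * k.-tuple (RM R) | slice S p.1 (col_of_tuple p.2)]
    = setT `&` g @^-1` (@col_of_tuple R k.+1 @^-1` S).
  by rewrite setTI; apply/seteqP; split => p; rewrite /= col_of_tuple_cons.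
exact: mg.
Qed.

Lemma measurable_volume_slice k (S : set 'cV[R]_(1 + k)) : borel S ->
  measurable_fun setT ((fun t => lebesgue_volume (slice S t)) : RM R -> \bar R).
Proof.
move=> /borel_slice2 mS.
exact: (@lebesgue_volume_measurable k _ _ [set p | slice S p.1 p.2]).
Qed.

Lemma borel_slice k (S : set 'cV[R]_(1 + k)) t : borel S -> borel (slice S t).
Proof.
move=> mS; apply: (@borel_map k (1 + k) (fun y => col_mx (t%:M : 'cV[R]_1) y) S) => // i.
case: (@split_ordP 1 k i) => j ->;
  [under eq_fun do rewrite col_mxEu | under eq_fun do rewrite col_mxEd].
  exact: measurable_cst.
exact: measurable_col_of_tuple.
Qed.

End VolumeMeasurability.

(** * Invariance of the volume under elementary maps *)

Section VolumeInvariance.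
Context {R : realType}.

(** By uniqueness of Lebesgue measure, it is enough to compare both sides on
    half-open intervals. *)
Lemma lebesgue_measure_affine (a b : R) (A : set R) : a != 0 ->
  measurable A ->
  (`|a|%:E * @lebesgue_measure R ((fun x : R => a * x + b)%R @^-1` A) = lebesgue_measure A)%E.
Proof.
move=> a0 mA; pose phi (x : RM R) : RM R := a * x + b.
have mphi : measurable_fun setT phi.
  by apply: measurable_funD => //; exact: mulrl_measurable.
pose pk : {nonneg R} := NngNum (normr_ge0 a).
pose phi' : {mfun RM R >-> RM R} := HB.pack phi (isMeasurableFun.Build _ _ _ _ _ mphi).
have -> : (`|a|%:E * @lebesgue_measure R ((fun x => a * x + b)%R @^-1` A))%E =
    mscale pk (pushforward (@lebesgue_measure R) phi') A by [].
apply/esym/lebesgue_measure_unique => // _ [[u v] _ <-].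
rewrite -[RHS]/(`|a|%:E * @lebesgue_measure R (phi @^-1` `]u, v]%classic))%E.
rewrite lebesgue_measure_itv /=.
have [agt|alt] := ltP 0 a.
  have -> : phi @^-1` `]u, v]%classic = `](u - b) / a, (v - b) / a]%classic.
    apply/seteqP; split => x /=; rewrite !in_itv /= /phi ltr_pdivrMr// ler_pdivlMr//;
    by rewrite ltrBlDr lerBrDr mulrC.
  rewrite lebesgue_measure_itv /= !lte_fin ltr_pM2r ?invr_gt0// ltrD2r.
  case: ifPn => // _; rewrite ?mule0// -!EFinB -EFinM; congr EFin.
  by rewrite gtr0_norm//; field.
have alt0 : a < 0 by rewrite lt_neqAle a0.
have -> : phi @^-1` `]u, v]%classic = `[(v - b) / a, (u - b) / a[%classic.
  apply/seteqP; split => x /=; rewrite !in_itv /= /phi ler_ndivrMr// ltr_ndivlMr//;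
  by rewrite ltrBlDr lerBrDr mulrC andbC.
rewrite lebesgue_measure_itv /= !lte_fin ltr_nM2r ?invr_lt0// ltrD2r.
case: ifPn => // _; rewrite ?mule0// -!EFinB -EFinM; congr EFin.
by rewrite ltr0_norm//; field.
Qed.

Lemma integral_affine (a b : R) (f : R -> \bar R) : a != 0 ->
  measurable_fun setT (f : RM R -> \bar R) -> (forall x, 0 <= f x)%E ->
  (\int[@lebesgue_measure R]_x f (a * x + b)%R * `|a|%:E
    = \int[@lebesgue_measure R]_x f x)%E.
Proof.
move=> a0 mf f0; pose phi (x : RM R) : RM R := a * x + b.
have mphi : measurable_fun setT phi.
  by apply: measurable_funD => //; exact: mulrl_measurable.
pose pk : {nonneg R} := NngNum (normr_ge0 a).
pose phi' : {mfun RM R >-> RM R} := HB.pack phi (isMeasurableFun.Build _ _ _ _ _ mphi).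
rewrite [RHS](eq_measure_integral (mscale pk (pushforward (@lebesgue_measure R) phi'))); last first.
  by move=> A mA _; exact/esym/(lebesgue_measure_affine b a0 mA).
by rewrite ge0_integral_mscale// ge0_integral_pushforward// muleC.
Qed.

Lemma lebesgue_volumeU k (S T : set 'cV[R]_k) : borel S -> borel T ->
  S `&` T = set0 ->
  lebesgue_volume (S `|` T) = (lebesgue_volume S + lebesgue_volume T)%E.
Proof.
elim: k S T => [|k IH] S T mS mT ST0.
  have : ~ (S 0 /\ T 0) by move=> [s t]; have : (S `&` T) 0 by []; rewrite ST0.
  rewrite /= -EFinD -natrD => ST; congr (_%:R%:E).
  case: (boolP (0 \in S)); case: (boolP (0 \in T)); rewrite !(inE, notin_setE) /=.
  - by move=> t s; case: ST.
  - by move=> t s; rewrite mem_set//; left.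
  - by move=> t s; rewrite mem_set//; right.
  - by move=> t s; rewrite memNset// => -[].
rewrite (@volumeS R k) -ge0_integralD//.
- apply: eq_integral => t _.
  rewrite -(IH (slice S t) (slice T t)) //; [exact: borel_slice|exact: borel_slice|].
  by rewrite -subset0 => y sty; have : (S `&` T) (col_mx t%:M y) by []; rewrite ST0.
- by move=> t _; exact: lebesgue_volume_ge0.
- exact: measurable_volume_slice.
- by move=> t _; exact: lebesgue_volume_ge0.
- exact: measurable_volume_slice.
Qed.

Lemma lebesgue_volume_translate k (w : 'cV[R]_k) (S : set 'cV[R]_k) : borel S ->
  lebesgue_volume [set x | S (x + w)] = lebesgue_volume S.
Proof.
elim: k w S => [|k IH] w S mS.
  by congr lebesgue_volume; apply/seteqP; split => x /=; rewrite (flatmx0 w) addr0.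
rewrite (@volumeS R k) -(@vsubmxK _ 1 k 1 w).
set w0 := @usubmx _ 1 k 1 w; set w1 := @dsubmx _ 1 k 1 w.
have mV := measurable_volume_slice mS.
rewrite -[RHS](@integral_affine 1 (w0 0 0) (fun t => lebesgue_volume (slice S t)))//; last first.
- by move=> t; exact: lebesgue_volume_ge0.
rewrite normr1 mule1; apply: eq_integral => t _.
rewrite mul1r -[RHS](IH w1) //; last exact: borel_slice.
congr lebesgue_volume; apply/funext => y; rewrite /slice /=; congr S.
by apply: etrans (@add_col_mx _ 1 k 1 _ _ _ _) _; rewrite raddfD/= -(mx11_scalar w0).
Qed.

(** Speaking of preimages rather than images keeps measurability for free and
    makes the property stable under composition. *)
Definition scales_volume k (f : 'cV[R]_k -> 'cV[R]_k) (a : R) : Prop :=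
  forall S, borel S -> borel (f @^-1` S) /\
    (lebesgue_volume (f @^-1` S) * a%:E = lebesgue_volume S)%E.

Lemma scales_volume_comp k (f g : 'cV[R]_k -> 'cV[R]_k) a b :
  scales_volume f a -> scales_volume g b -> scales_volume (f \o g) (a * b).
Proof.
move=> sf sg S mS; have [mfS eS] := sf S mS; have [mgfS eS'] := sg _ mfS.
by split => //; rewrite EFinM [(a%:E * _)%E]muleC muleA comp_preimage eS' eS.
Qed.

Definition mx_scales k (N : 'M[R]_k) := scales_volume (mulmx N) `|\det N|.

Lemma mx_scalesM k (N1 N2 : 'M[R]_k) :
  mx_scales N1 -> mx_scales N2 -> mx_scales (N1 *m N2).
Proof.
move=> s1 s2; rewrite /mx_scales det_mulmx normrM.
have -> : mulmx (N1 *m N2) = mulmx N1 \o mulmx N2 :> ('cV[R]_k -> 'cV[R]_k).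
  by apply/funext => x /=; rewrite mulmxA.
exact: scales_volume_comp.
Qed.

Lemma mx_scales1 k : mx_scales (1%:M : 'M[R]_k).
Proof.
have e : mulmx 1%:M = id :> ('cV[R]_k -> 'cV[R]_k) by apply/funext => x; rewrite mul1mx.
by move=> S mS; rewrite e det1 normr1 mule1.
Qed.

Lemma borel_mulmx k l (N : 'M[R]_(l, k)) S : borel S -> borel (mulmx N @^-1` S : set 'cV[R]_k).
Proof.
apply: borel_map => i; under eq_fun do rewrite mxE.
apply: measurable_sum => j.
apply: measurable_funM; first exact: measurable_cst.
exact: measurable_col_of_tuple.
Qed.

Lemma mx_scales_block1 k (N : 'M[R]_k) : mx_scales N ->
  mx_scales (block_mx 1%:M 0 0 N : 'M[R]_(1 + k)).
Proof.
move=> sN S mS; split; first exact: borel_mulmx.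
rewrite (@det_ublock _ 1 k) det1 mul1r.
rewrite !(@volumeS R k) muleC -ge0_integralZl//=; last 2 first.
- by apply: measurable_volume_slice; exact: borel_mulmx.
- by move=> t _; exact: lebesgue_volume_ge0.
apply: eq_integral => t _.
have [_ <-] := sN _ (borel_slice t mS).
rewrite muleC; congr (lebesgue_volume _ * _)%E.
apply/seteqP; split => y; rewrite /slice /=;
  by rewrite (@mul_block_col _ 1 k 1 k) mul1mx !mul0mx add0r addr0.
Qed.

Lemma mx_scales_dilation k (a : R) : a != 0 ->
  mx_scales (block_mx a%:M 0 0 1%:M : 'M[R]_(1 + k)).
Proof.
move=> a0 S mS; split; first exact: borel_mulmx.
rewrite (@det_ublock _ 1 k) det1 mulr1 det_scalar expr1.
rewrite !(@volumeS R k).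
rewrite -[RHS](@integral_affine a 0)//; last 2 first.
- exact: measurable_volume_slice.
- by move=> t; exact: lebesgue_volume_ge0.
congr (_ * _)%E; apply: eq_integral => t _; rewrite addr0.
congr lebesgue_volume; apply/seteqP; split => y; rewrite /slice /=;
  by rewrite (@mul_block_col _ 1 k 1 k) mul1mx !mul0mx add0r addr0 -scalar_mxM.
Qed.

(** On each slice such a shear is a translation. *)
Lemma mx_scales_lower_shear k (w : 'cV[R]_k) :
  mx_scales (block_mx 1%:M 0 w 1%:M : 'M[R]_(1 + k)).
Proof.
move=> S mS; split; first exact: borel_mulmx.
rewrite (@det_lblock _ 1 k) !det1 mulr1 normr1 mule1 !(@volumeS R k).
apply: eq_integral => t _.
rewrite -[RHS](lebesgue_volume_translate (t *: w))//; last exact: borel_slice.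
congr lebesgue_volume; apply/seteqP; split => y; rewrite /slice /=;
  by rewrite (@mul_block_col _ 1 k 1 k) !mul1mx !mul0mx addr0 mul_mx_scalar addrC.
Qed.

(** Slicing singles out the first coordinate; exchanging it with the second one is
    the one move that needs Tonelli's theorem. *)
Definition swap01 k (x : 'cV[R]_(1 + (1 + k))) : 'cV[R]_(1 + (1 + k)) :=
  col_mx (usubmx (dsubmx x)) (col_mx (usubmx x) (dsubmx (dsubmx x))).

Lemma scales_volume_swap01 k : scales_volume (@swap01 k) 1.
Proof.
move=> S mS; rewrite mule1.
have swapE t s y : swap01 (col_mx t%:M (col_mx s%:M y)) = col_mx s%:M (col_mx t%:M y)
  :> 'cV_(1 + (1 + k)).
  by rewrite /swap01 !(col_mxKu, col_mxKd).
have mswap : borel (@swap01 k @^-1` S).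
  apply: (@borel_map R (1 + (1 + k)) (1 + (1 + k))) => // i.
  case: (split_ordP i) => [i' ->|i' ->].
    under eq_fun do rewrite col_mxEu !mxE.
    exact: measurable_tnth.
  case: (split_ordP i') => [i'' ->|i'' ->].
    under eq_fun do rewrite col_mxEd col_mxEu !mxE.
    exact: measurable_tnth.
  under eq_fun do rewrite !col_mxEd !mxE.
  exact: measurable_tnth.
split; first exact: mswap.
pose F (p : RM R * RM R) : \bar R := lebesgue_volume (slice (slice S p.1) p.2).
have mF : measurable_fun setT F.
  apply: (@lebesgue_volume_measurable R k _ (RM R * RM R)%type
    [set p | S (col_mx p.1.1%:M (col_mx p.1.2%:M p.2))]).
  pose g (p : (RM R * RM R) * k.-tuple (RM R)) : k.+2.-tuple (RM R) :=
    [tuple of p.1.1 :: [tuple of p.1.2 :: p.2]].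
  have mg : measurable_fun setT g.
    apply: measurable_cons; first exact: measurableT_comp.
    by apply: measurable_cons => //; exact: measurableT_comp.
  rewrite (_ : [set p | _] = setT `&` g @^-1` (@col_of_tuple R k.+2 @^-1` S)).
    exact: mg.
  rewrite setTI; apply/seteqP; split => p /=;
    by rewrite (@col_of_tuple_cons R k.+1) (@col_of_tuple_cons R k).
transitivity (\int[@lebesgue_measure R]_t \int[@lebesgue_measure R]_s F (s, t))%E.
  apply: eq_integral => t _; apply: eq_integral => s _.
  congr lebesgue_volume; apply/funext => y; rewrite /slice /=; congr S.
  exact: swapE.
rewrite -(@fubini_tonelli _ _ _ _ _ (@lebesgue_measure R) (@lebesgue_measure R) F)//.
by move=> p; exact: lebesgue_volume_ge0.
Qed.

End VolumeInvariance.

(** * Linear change of variables *)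

Section LinearChangeOfVariables.
Context {R : realType}.

(** Conjugating a lower shear by the exchange of the first two coordinates. *)
Lemma mx_scales_upper_shear0 k (a : R) :
  mx_scales (block_mx 1%:M (row_mx a%:M 0) 0 1%:M : 'M[R]_(1 + (1 + k))).
Proof.
set U := block_mx _ _ _ _.
have -> : mx_scales U = scales_volume (@swap01 R k \o
    (mulmx (block_mx 1%:M 0 (col_mx a%:M 0) 1%:M : 'M[R]_(1 + (1 + k))) \o @swap01 R k))
    (1 * (`|\det (block_mx 1%:M 0 (col_mx a%:M 0) 1%:M : 'M[R]_(1 + (1 + k)))| * 1)).
  rewrite /mx_scales det_ublock det_lblock !det1 !mulr1 mul1r; congr scales_volume.
  apply/funext => x /=.
  rewrite -[x]vsubmxK -[dsubmx x]vsubmxK.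
  move: (usubmx x) (usubmx (dsubmx x)) (dsubmx (dsubmx x)) => t s y.
  rewrite /swap01 !(col_mxKu, col_mxKd) !mul_block_col !mul1mx !mul0mx addr0 add0r.
  rewrite mul_row_col mul_col_mx !mul0mx addr0 !add_col_mx !(col_mxKu, col_mxKd) add0r.
  by rewrite addrC.
have s := @scales_volume_swap01 R k.
exact: (scales_volume_comp s (scales_volume_comp (mx_scales_lower_shear (col_mx a%:M 0)) s)).
Qed.

(** A nonzero row is a multiple of the first row of an invertible matrix, so the
    shear is conjugate, by maps fixing the first coordinate, to the one above. *)
Lemma mx_scales_upper_shear k (r : 'rV[R]_k) :
  (forall N : 'M[R]_k, N \in unitmx -> mx_scales N) ->
  mx_scales (block_mx 1%:M r 0 1%:M : 'M[R]_(1 + k)).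
Proof.
move=> Qk; have [->|r0] := eqVneq r 0; first by rewrite -scalar_mx_block; apply: mx_scales1.
case: k r Qk r0 => [|k] r Qk r0; first by rewrite thinmx0 eqxx in r0.
pose N : 'M[R]_(1 + k) := row_ebase r; have uN : N \in unitmx := row_ebase_unit r.
have rE : r = row_mx (col_ebase r 0 0)%:M 0 *m N.
  rewrite -{1}(mulmx_ebase r); congr (_ *m _).
  rewrite rank_rV r0 {1}[col_ebase r]mx11_scalar mul_scalar_mx.
  apply/rowP => j; rewrite !mxE; case: (@split_ordP 1 k j) => j' ->.
    by rewrite ord1 mulr1 !mxE.
  by rewrite !mxE mulr0.
have -> : block_mx 1%:M r 0 1%:M = block_mx 1%:M 0 0 (invmx N)
    *m block_mx 1%:M (row_mx (col_ebase r 0 0)%:M 0) 0 1%:M *m block_mx 1%:M 0 0 N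
    :> 'M[R]_(1 + (1 + k)).
  rewrite !mulmx_block !(mul1mx, mulmx1, mul0mx, mulmx0, addr0, add0r).
  by rewrite -rE mulVmx.
apply: mx_scalesM; first apply: mx_scalesM.
- by apply/mx_scales_block1/Qk; rewrite unitmx_inv.
- exact: mx_scales_upper_shear0.
- exact/mx_scales_block1/Qk.
Qed.

(** Block elimination: with a nonzero upper left entry, an invertible matrix is a
    product of a lower shear, a dilation of the first coordinate, a map of the
    other coordinates and an upper shear. *)
Lemma volume_linear_preimage k (N : 'M[R]_k) : N \in unitmx -> mx_scales N.
Proof.
elim: k N => [|k IH] N uN.
  move=> S mS; split; first exact: borel_mulmx.
  rewrite det_mx00 normr1 mule1; congr lebesgue_volume.
  by apply/funext => x /=; rewrite flatmx0 [x]flatmx0.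
have pivot (M : 'M[R]_(1 + k)) : M \in unitmx -> ulsubmx M 0 0 != 0 -> mx_scales M.
  move=> uM; set a := ulsubmx M 0 0 => a0.
  pose b := ursubmx M; pose c := dlsubmx M; pose D := drsubmx M - a^-1 *: (c *m b).
  have ME : M = block_mx 1%:M 0 (a^-1 *: c) 1%:M *m block_mx a%:M 0 0 1%:M
      *m block_mx 1%:M 0 0 D *m block_mx 1%:M (a^-1 *: b) 0 1%:M.
    rewrite !mulmx_block !(mul1mx, mulmx1, mul0mx, mulmx0, addr0, add0r).
    rewrite !mul_mx_scalar !mul_scalar_mx !scalerA mulfV// !scale1r -scalemxAr.
    by rewrite addrC subrK -[in LHS](submxK M) -(mx11_scalar (ulsubmx M)).
  have uD : D \in unitmx.
    move: uM; rewrite [in X in X -> _]ME !unitmx_mul => /andP[/andP[_]].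
    by rewrite {1}unitmxE (@det_ublock _ 1 k) det1 mul1r -unitmxE.
  rewrite ME; apply: mx_scalesM; last exact: mx_scales_upper_shear.
  apply: mx_scalesM; last exact/mx_scales_block1/IH.
  apply: mx_scalesM; first exact: mx_scales_lower_shear.
  exact: mx_scales_dilation.
move: N uN; rewrite -[k.+1]/(1 + k)%N => N uN.
(* A vanishing pivot is repaired by adding another row to the first one. *)
have [a0|] := eqVneq (@ulsubmx _ 1 k 1 k N 0 0) 0; last exact: pivot.
pose c := @dlsubmx _ 1 k 1 k N.
have : c != 0.
  apply: contraTneq uN => c0; rewrite unitmxE -(@submxK _ 1 k 1 k N) -/c c0.
  rewrite (@det_ublock _ 1 k) (mx11_scalar (ulsubmx _)) a0 det_scalar expr1 mul0r.
  by rewrite unitr0.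
case/matrix0Pn => i [j ci]; rewrite ord1 in ci.
pose r : 'rV[R]_k := delta_mx 0 i.
pose U (s : 'rV[R]_k) : 'M[R]_(1 + k) := block_mx 1%:M s 0 1%:M.
have UU : U (- r) *m U r = 1%:M.
  rewrite /U mulmx_block !(mul1mx, mulmx1, mul0mx, mulmx0, addr0, add0r) addrN.
  by rewrite -scalar_mx_block.
have -> : N = U (- r) *m (U r *m N) by rewrite mulmxA UU mul1mx.
apply: mx_scalesM; first exact: mx_scales_upper_shear.
apply: pivot.
  by rewrite unitmx_mul uN andbT; case/mulmx1_unit: UU.
rewrite -(@submxK _ 1 k 1 k N) /U mulmx_block block_mxKul mul1mx mxE a0 add0r mxE.
rewrite (bigD1 i)//= mxE !eqxx mul1r big1 ?addr0// => l li.
by rewrite mxE (negbTE li) andbF mul0r.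
Qed.

End LinearChangeOfVariables.

(** * The volume of a simplex *)

Section SimplexVolume.
Context {R : realType}.
Notation mu := (@lebesgue_measure R).

Lemma borelC k (S : set 'cV[R]_k) : borel S -> borel (~` S).
Proof. by move=> mS; rewrite /borel preimage_setC; exact: measurableC. Qed.

Lemma borelI k (S T : set 'cV[R]_k) : borel S -> borel T -> borel (S `&` T).
Proof. by move=> mS mT; rewrite /borel preimage_setI; exact: measurableI. Qed.

Lemma borelD k (S T : set 'cV[R]_k) : borel S -> borel T -> borel (S `\` T).
Proof. by move=> mS mT; rewrite setDE; apply: borelI => //; exact: borelC. Qed.

Lemma borelU k (S T : set 'cV[R]_k) : borel S -> borel T -> borel (S `|` T).
Proof. by move=> mS mT; rewrite /borel preimage_setU; exact: measurableU. Qed.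

Lemma borel0 k : borel (set0 : set 'cV[R]_k).
Proof. by rewrite /borel preimage_set0; exact: measurable0. Qed.

Lemma borel_forall k (I : finType) (F : I -> set 'cV[R]_k) :
  (forall i, borel (F i)) -> borel [set x | forall i, F i x].
Proof.
move=> mF; rewrite (_ : [set x | _] = \bigcap_(i in [set: I]) F i); last first.
  by apply/seteqP; split => x Fx i => //; exact: Fx.
rewrite /borel preimage_bigcap; apply: fin_bigcap_measurable => // i _; exact: mF.
Qed.

Lemma borel_imply k (P : Prop) (S : set 'cV[R]_k) :
  borel S -> borel [set x | P -> S x].
Proof.
move=> mS; have [p|np] := pselect P.
  by rewrite (_ : [set x | _] = S)//; apply/seteqP; split => x /= // h; exact: h.
rewrite (_ : [set x | _] = ~` set0); first exact: borelC (@borel0 k).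
by apply/seteqP; split => x /=; [move=> _ []|move=> _ p; case: np].
Qed.

Lemma borel_linear_lteif k (b : bool) (u : 'rV[R]_k) (c : R) :
  borel [set x | c < (u *m x) 0 0 ?<= if b].
Proof.
pose f (t : k.-tuple (RM R)) : RM R := (u *m col_of_tuple t) 0 0.
have mf : measurable_fun setT f.
  rewrite /f; under eq_fun do rewrite mxE.
  apply: measurable_sum => j; apply: measurable_funM; first exact: measurable_cst.
  exact: measurable_col_of_tuple.
have := mf measurableT [set` Interval (BSide b c) +oo%O] (measurable_itv _).
rewrite setTI; congr measurable; apply/seteqP; split => t /=;
  by rewrite in_itv /= andbT; case: b.
Qed.

Lemma le_lebesgue_volume k (S T : set 'cV[R]_k) : borel S -> borel T ->
  S `<=` T -> (lebesgue_volume S <= lebesgue_volume T)%E.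
Proof.
move=> mS mT ST; rewrite -(setDUK ST) lebesgue_volumeU//; first 2 last.
- by rewrite -subset0 => x [Sx [_ /(_ Sx)]].
- by rewrite leeDl//; exact: lebesgue_volume_ge0.
- exact: borelD.
Qed.

(** The open and the closed standard simplex: the two have the same volume, hence
    so does every measurable set between them, whichever facets it contains. *)
Definition simplex (b : bool) k (s : R) : set 'cV[R]_k :=
  [set x | (forall i, 0 < x i 0 ?<= if b) /\ \sum_i x i 0 < s ?<= if b].

Lemma borel_simplex b k s : borel (@simplex b k s).
Proof.
apply: (@borelI _ [set x | forall i, _]); first apply: borel_forall => i.
  have := borel_linear_lteif b (delta_mx 0 i : 'rV[R]_k) 0.
  by congr borel; apply/seteqP; split => x /=; rewrite -rowE mxE.
have := borel_linear_lteif b (const_mx (- 1) : 'rV[R]_k) (- s).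
congr borel; apply/funext => x /=.
have -> : ((const_mx (- 1) : 'rV[R]_k) *m x) 0 0 = - \sum_i x i 0.
  by rewrite mxE -sumrN; apply: eq_bigr => i _; rewrite mxE mulN1r.
by rewrite lteifN2.
Qed.

Lemma integral_deriv_poly (p : {poly R}) (a b : R) : a < b ->
  (\int[mu]_(x in `[a, b]) (p^`().[x])%:E = (p.[b])%:E - (p.[a])%:E)%E.
Proof.
move=> ab; apply: (@continuous_FTC2 _ (horner p^`()) (horner p)) => //.
- by apply: continuous_subspaceT => x; exact: continuous_horner.
- split.
  + by move=> x _; exact: derivable_horner.
  + by apply: cvg_at_right_filter; exact: continuous_horner.
  + by apply: cvg_at_left_filter; exact: continuous_horner.
- by move=> x _; rewrite derivE.
Qed.

Lemma integral_onemX k (s : R) : 0 < s ->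
  (\int[mu]_(t in `[0%R, s]) ((s - t) ^+ k / k`!%:R)%:E = (s ^+ k.+1 / k.+1`!%:R)%:E)%E.
Proof.
move=> s0; pose p : {poly R} := - (k.+1`!%:R^-1 *: (s%:P - 'X) ^+ k.+1).
transitivity (\int[mu]_(t in `[0%R, s]) (p^`().[t])%:E)%E.
  apply: eq_integral => t _; congr EFin.
  rewrite /p derivN derivZ deriv_exp derivB derivC derivX sub0r mulN1r.
  rewrite !(hornerE, hornerMn) /= factS natrM invfM -mulr_natl.
  have k0 : k.+1%:R != 0 :> R by rewrite pnatr_eq0.
  have f0 : k`!%:R != 0 :> R by rewrite pnatr_eq0 -lt0n fact_gt0.
  by field; rewrite f0 addrC natr1.
rewrite integral_deriv_poly// -EFinB; congr EFin.
have pE t : p.[t] = - ((s - t) ^+ k.+1 / k.+1`!%:R).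
  by rewrite /p hornerN hornerZ horner_exp hornerD hornerN hornerC hornerX mulrC.
by rewrite !pE subrr expr0n /= mul0r subr0 oppr0 sub0r opprK.
Qed.

Lemma slice_simplex b k (s t : R) :
  slice (@simplex b k.+1 s) t =
    if 0 < t ?<= if b then @simplex b k (s - t) else set0.
Proof.
have sE (y : 'cV[R]_k) : \sum_i (col_mx (t%:M : 'cV_1) y) i 0 = t + \sum_i y i 0.
  rewrite big_split_ord /= big_ord1 col_mxEu mxE eqxx mulr1n.
  by congr (_ + _); apply: eq_bigr => i _; rewrite col_mxEd.
apply/seteqP; split => y; rewrite /slice /simplex /=.
  move=> [y0 ys]; have := y0 (@lshift 1 k ord0).
  rewrite (@col_mxEu _ 1 k 1) mxE eqxx mulr1n => ->; split.
    by move=> i; have := y0 (@rshift 1 k i); rewrite (@col_mxEd _ 1 k 1).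
  by move: ys; rewrite sE lteifBrDl.
case: ifP => // t0 [y0 ys]; split.
  move=> i; case: (@split_ordP 1 k i) => j ->; last by rewrite (@col_mxEd _ 1 k 1).
  by rewrite (@col_mxEu _ 1 k 1) mxE (ord1 j) eqxx mulr1n.
by rewrite sE -lteifBrDl.
Qed.

(** Slices of a simplex are smaller simplices, so the volume is obtained by
    integrating a power. *)
Lemma volume_simplex b k (s : R) : 0 < s ->
  lebesgue_volume (@simplex b k s) = (s ^+ k / k`!%:R)%:E.
Proof.
elim: k s => [|k IH] s s0.
  rewrite /= expr0 fact0 divr1; rewrite mem_set//; split; first by case.
  by rewrite big_ord0; exact: lteifS.
rewrite (@volumeS R k).
pose F t := lebesgue_volume (slice (@simplex b k.+1 s) t).
have mF : measurable_fun setT (F : RM R -> \bar R).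
  by apply: measurable_volume_slice; exact: borel_simplex.
have vol0 : lebesgue_volume (set0 : set 'cV[R]_k) = 0%E.
  by elim: (k) => [|l IHl] /=; [rewrite memNset|apply: integral0_eq => t _].
have -> : (\int[mu]_t F t = \int[mu]_(t in `[0%R, s]) F t)%E.
  rewrite [RHS]integral_mkcond; apply: eq_integral => t _.
  rewrite patchE; case: ifPn => //; rewrite notin_setE /= in_itv /= => ts.
  rewrite /F slice_simplex; case: ifP => // t0.
  rewrite (_ : simplex b (s - t) = set0)//; rewrite -subset0 => y [y0 ys]; apply: ts.
  rewrite (lteifW t0) /= -subr_ge0; apply: le_trans (lteifW ys).
  by apply: sumr_ge0 => i _; exact: lteifW.
(* The two end slices may be degenerate; they are discarded as null. *)
rewrite -[RHS]integral_onemX// integral_itv_bndoo; last exact: measurable_funTS.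
rewrite [RHS]integral_itv_bndoo; last first.
  apply/measurable_EFinP/measurable_funTS; apply: measurable_funM => //.
  by apply: measurable_funX; apply: measurable_funB.
apply: eq_integral => t; rewrite inE /= in_itv /= => /andP[t0 ts].
by rewrite /F slice_simplex (lteifS _ t0) IH// subr_gt0.
Qed.

Lemma volume_sandwich k (S : set 'cV[R]_k) : borel S ->
  @simplex false k 1 `<=` S -> S `<=` @simplex true k 1 ->
  lebesgue_volume S = (k`!%:R^-1)%:E.
Proof.
move=> mS lS Su; apply/eqP; rewrite eq_le; apply/andP; split.
- have := le_lebesgue_volume mS (borel_simplex _ _) Su.
  by rewrite volume_simplex// expr1n mul1r.
- have := le_lebesgue_volume (borel_simplex _ _) mS lS.
  by rewrite volume_simplex// expr1n mul1r.
Qed.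

End SimplexVolume.

(** * The pyramid over a circuit *)

Section CircuitVolume.
Context {R : realType}.

Lemma bigsetU_ex (T : Type) (I : finType) (P : pred I) (F : I -> set T) (x : T) :
  (\big[setU/set0]_(i | P i) F i) x <-> exists2 i, P i & F i x.
Proof.
rewrite -bigcup_seq_cond; split => [[i /= /andP[_ Pi] Fi]|[i Pi Fi]]; exists i => //=.
by rewrite mem_index_enum Pi.
Qed.

Lemma lebesgue_volume_bigsetU k (I : finType) (P : pred I) (F : I -> set 'cV[R]_k) :
  (forall i, P i -> borel (F i)) ->
  (forall i j, P i -> P j -> i != j -> F i `&` F j = set0) ->
  borel (\big[setU/set0]_(i | P i) F i) /\
  lebesgue_volume (\big[setU/set0]_(i | P i) F i) =
    (\sum_(i | P i) lebesgue_volume (F i))%E.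
Proof.
move=> mF dF.
elim: (index_enum I) (index_enum_uniq I) => [_|i s IH /= /andP[si us]].
  rewrite !big_nil; split; first exact: borel0.
  have vol0 : lebesgue_volume (set0 : set 'cV[R]_k) = 0%E; last exact: vol0.
  by elim: (k) => [|l IHl] /=; [rewrite memNset|apply: integral0_eq => t _].
have [mU vU] := IH us.
rewrite !big_cons; case: ifPn => // Pi; split; first by apply: borelU => //; exact: mF.
rewrite lebesgue_volumeU ?vU//; first exact: mF.
rewrite -subset0 => x [Fix]; rewrite -bigcup_seq_cond => -[j /= /andP[js Pj] Fjx].
have ij : i != j by apply: contraNneq si => ->.
by have : (F i `&` F j) x by []; rewrite dF.
Qed.

(** Simplices with apex 0 that omit the [i]-th generator. The strict
    inequalities break ties towards the smallest index, which makes the cells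
    attached to the positive entries of a relation [c] disjoint. *)
Definition cell (b : bool) k (E : 'M[R]_(k, k.+1)) (c : 'cV[R]_k.+1) (i : 'I_k.+1) :=
  [set E *m l | l in [set l : 'cV[R]_k.+1 |
    [/\ forall j, 0 <= l j 0, \sum_j l j 0 < 1 ?<= if b, l i 0 = 0
      & forall j : 'I_k.+1, (j < i)%N -> 0 < c j 0 -> 0 < l j 0]]].

Lemma mulmx_col'_row' k (E : 'M[R]_(k, k.+1)) (l : 'cV[R]_k.+1) i : l i 0 = 0 ->
  E *m l = col' i E *m row' i l.
Proof.
move=> li; apply/colP => r; rewrite !mxE (bigD1_ord i) //= li mulr0 add0r.
by apply: eq_bigr => j _; rewrite !mxE.
Qed.

Lemma volume_cell b k (E : 'M[R]_(k, k.+1)) c i : \det (col' i E) != 0 ->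
  borel (cell b E c i) /\
  lebesgue_volume (cell b E c i) = (`|\det (col' i E)| / k`!%:R)%:E.
Proof.
move=> dE; have uE : col' i E \in unitmx by rewrite unitmxE unitfE.
pose S := [set l : 'cV[R]_k | forall j, 0 <= l j 0] `&`
  ([set l : 'cV[R]_k | \sum_j l j 0 < 1 ?<= if b] `&`
   [set l : 'cV[R]_k | forall j, (lift i j < i)%N /\ 0 < c (lift i j) 0 -> 0 < l j 0]).
have coordE (j : 'I_k) (l : 'cV[R]_k) : ((delta_mx 0 j : 'rV[R]_k) *m l) 0 0 = l j 0.
  by rewrite -rowE mxE.
have mS : borel S.
  apply: borelI; first apply: borel_forall => j.
    have := borel_linear_lteif true (delta_mx 0 j : 'rV[R]_k) 0.
    by congr borel; apply/funext => l /=; rewrite coordE.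
  apply: borelI; last first.
    apply: borel_forall => j; apply: borel_imply.
    have := borel_linear_lteif false (delta_mx 0 j : 'rV[R]_k) 0.
    by congr borel; apply/funext => l /=; rewrite coordE.
  have := borel_linear_lteif b (const_mx (- 1) : 'rV[R]_k) (- 1).
  congr borel; apply/funext => x /=.
  have -> : ((const_mx (- 1) : 'rV[R]_k) *m x) 0 0 = - \sum_i x i 0.
    by rewrite mxE -sumrN; apply: eq_bigr => j _; rewrite mxE mulN1r.
  by rewrite lteifN2.
have vS : lebesgue_volume S = (k`!%:R^-1)%:E.
  apply: volume_sandwich => // l.
    move=> [/= l0 l1]; split; first by move=> j; exact/ltW/l0.
    by split; [exact: lteifS | move=> j _; exact: l0].
  by move=> [/= l0 [/lteifW l1 _]]; split.
pose N := invmx (col' i E).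
have uN : N \in unitmx by rewrite unitmx_inv.
have cE : cell b E c i = mulmx N @^-1` S.
  apply/seteqP; split => y /=.
    move=> [l [l0 l1 li lc] <-]; rewrite (mulmx_col'_row' _ li) mulKmx//.
    split; first by move=> j; rewrite mxE; exact: l0.
    split => [|j [ji cj]]; last by rewrite mxE; exact: lc.
    move: l1; rewrite (bigD1_ord i)//= li add0r.
    by rewrite (eq_bigr (fun j => row' i l j 0))// => j _; rewrite mxE.
  move=> [/= l0 [l1 lc]].
  pose l : 'cV[R]_k.+1 := \col_j if unlift i j is Some j' then (N *m y) j' 0 else 0.
  have li : l i 0 = 0 by rewrite mxE unlift_none.
  have lj j : l (lift i j) 0 = (N *m y) j 0 by rewrite mxE liftK.
  exists l; last first.
    rewrite (mulmx_col'_row' _ li) (_ : row' i l = N *m y) ?mulKVmx//.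
    by apply/colP => j; rewrite mxE lj.
  split => //.
  - by move=> j; case: (unliftP i j) => [j' ->|->]; rewrite ?lj ?li.
  - by rewrite (bigD1_ord i)//= li add0r; under eq_bigr do rewrite lj.
  - by move=> j; case: (unliftP i j) => [j' ->|->]; rewrite ?lj ?ltnn// => ? ?; exact: lc.
have [mP vP] := volume_linear_preimage uN mS.
rewrite cE; split => //.
move: vP; rewrite vS det_inv normfV.
have d0 : `|\det (col' i E)| != 0 by rewrite normr_eq0.
move=> /(congr1 (fun z => (z * `|\det (col' i E)|%:E)%E)).
by rewrite -muleA -!EFinM mulVf// mule1 mulrC.
Qed.

Lemma circuit_kernel k (E : 'M[R]_(k, k.+1)) (c x : 'cV[R]_k.+1) i :
  E *m c = 0 -> c i 0 != 0 -> \det (col' i E) != 0 -> E *m x = 0 ->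
  x = (x i 0 / c i 0) *: c.
Proof.
move=> Ec ci dE Ex; have uE : col' i E \in unitmx by rewrite unitmxE unitfE.
apply/eqP; rewrite -subr_eq0; apply/eqP; set t := _ / _; set y := x - _.
have yi : y i 0 = 0 by rewrite !mxE divfK// subrr.
have : E *m y = 0 by rewrite mulmxBr -scalemxAr Ec Ex scaler0 subr0.
rewrite (mulmx_col'_row' _ yi) => /(congr1 (mulmx (invmx (col' i E)))).
rewrite mulKmx// mulmx0 => y0; apply/colP => j; rewrite [RHS]mxE.
by case: (unliftP i j) => [j' ->|-> //]; move/colP: y0 => /(_ j'); rewrite !mxE.
Qed.

(** Moving against the relation until the first coordinate vanishes, and choosing
    the smallest index among those that vanish together. *)
Lemma slide_to_boundary k (c l : 'cV[R]_k) : (exists i, 0 < c i 0) ->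
  (forall j, 0 <= l j 0) ->
  exists t i, [/\ 0 <= t, 0 < c i 0, (l - t *: c) i 0 = 0,
    forall j, 0 <= (l - t *: c) j 0
    & forall j : 'I_k, (j < i)%N -> 0 < c j 0 -> 0 < (l - t *: c) j 0].
Proof.
move=> [i0 ci0] l0; pose q j := l j 0 / c j 0.
case: (@arg_minP _ _ _ i0 (fun j => 0 < c j 0) q ci0) => i1 ci1 min1.
(* Among the minimizers of the ratio, the one of smallest index. *)
pose P j := (0 < c j 0) && (q j == q i1).
have Pi1 : P i1 by rewrite /P ci1 /=.
case: (arg_minnP (fun j : 'I_k => j : nat) Pi1) => i /andP[ci /eqP qi] mini.
have t0 : 0 <= q i1 by rewrite divr_ge0// ltW.
have ge j : 0 <= (l - q i1 *: c) j 0.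
  rewrite !mxE subr_ge0; have [cj|cj] := ltP 0 (c j 0).
    by rewrite -ler_pdivlMr//; exact: min1.
  by apply: le_trans (l0 j); rewrite mulr_ge0_le0.
exists (q i1), i; split => //; first by rewrite !mxE -qi divfK ?subrr// gt_eqF.
move=> j ji cj; rewrite lt_neqAle ge andbT.
apply: contraTneq ji => /esym; rewrite -leqNgt !mxE => /eqP.
by rewrite subr_eq0 => /eqP lj; apply: mini; rewrite /P cj /q lj mulfK ?eqxx// gt_eqF.
Qed.

Section Circuit.
Variables (k : nat) (E : 'M[R]_(k, k.+1)).
Hypothesis Emin : forall (c : 'cV[R]_k.+1) i, E *m c = 0 -> c i 0 != 0 -> \det (col' i E) != 0.

(** Two coefficient vectors of a point differ by a multiple of [c], so a point in
    the cells of [i < j] would force that multiple to be positive at [i] and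
    nonpositive at [j]. *)
Lemma volume_cells b (c : 'cV[R]_k.+1) : E *m c = 0 ->
  borel (\big[setU/set0]_(i | 0 < c i 0) cell b E c i) /\
  lebesgue_volume (\big[setU/set0]_(i | 0 < c i 0) cell b E c i) =
  ((\sum_(i | 0 < c i 0) `|\det (col' i E)|) / k`!%:R)%:E.
Proof.
move=> Ec; have dE i : 0 < c i 0 -> \det (col' i E) != 0.
  by move=> ci; apply: (Emin Ec); rewrite gt_eqF.
have [||mU ->] := @lebesgue_volume_bigsetU k _ (fun i => 0 < c i 0) (cell b E c).
- by move=> i ci; have [] := volume_cell b c (dE i ci).
- have key i j : 0 < c i 0 -> 0 < c j 0 -> (i < j)%N -> cell b E c i `&` cell b E c j = set0.
    move=> ci cj ij; rewrite -subset0 => x [[l [l0 _ li _] <-] [m [_ _ mj mc]]] /eqP.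
    rewrite -subr_eq0 -mulmxBr => /eqP Em.
    have := circuit_kernel Ec (lt0r_neq0 ci) (dE i ci) Em; set t := _ / _ => mlE.
    have /eqP := congr1 (fun z : 'cV_k.+1 => z j 0) mlE.
    have t0 : 0 < t by rewrite divr_gt0// !mxE li subr0; exact: mc.
    rewrite !mxE mj sub0r => /eqP lj.
    by have := mulr_gt0 t0 cj; rewrite -lj oppr_gt0 ltNge l0.
  move=> i j ci cj; rewrite neq_ltn => /orP[ij|ji]; first exact: key.
  by rewrite setIC; exact: key.
split => //; rewrite mulr_suml -sumEFin; apply: eq_bigr => i ci.
by have [] := volume_cell b c (dE i ci).
Qed.

Definition pyramid := [set E *m l | l in [set l : 'cV[R]_k.+1 |
  (forall j, 0 <= l j 0) /\ \sum_j l j 0 <= 1]].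

Definition hull := [set E *m l | l in [set l : 'cV[R]_k.+1 |
  (forall j, 0 <= l j 0) /\ \sum_j l j 0 = 1]].

Let sumB (l c : 'cV[R]_k.+1) t :
  \sum_j (l - t *: c) j 0 = \sum_j l j 0 - t * \sum_j c j 0.
Proof.
by rewrite mulr_sumr -sumrB; apply: eq_bigr => j _; rewrite !mxE.
Qed.

(** Sliding against a relation of nonnegative total does not increase the sum of
    the coefficients, so it stays inside the pyramid. *)
Lemma pyramid_cells (c : 'cV[R]_k.+1) : E *m c = 0 -> (exists i, 0 < c i 0) ->
  0 <= \sum_j c j 0 ->
  pyramid = \big[setU/set0]_(i | 0 < c i 0) cell true E c i.
Proof.
move=> Ec cpos sc; apply/seteqP; split => y.
  move=> [l [l0 l1] <-]; apply/bigsetU_ex.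
  have [t [i [t0 ci lti lt0 ltj]]] := slide_to_boundary cpos l0.
  exists i => //; exists (l - t *: c); last by rewrite mulmxBr -scalemxAr Ec scaler0 subr0.
  by split => //=; rewrite sumB (le_trans _ l1)// gerBl mulr_ge0.
move=> /bigsetU_ex[i ci [l [l0 l1 _ _] <-]].
by exists l.
Qed.

(** Sliding along [c] instead maximizes the sum of the coefficients. A point of
    the pyramid lies below the hull exactly when this maximum is less than 1:
    otherwise the sum takes the value 1 on the way. *)
Lemma pyramid_hull_cells (c : 'cV[R]_k.+1) : E *m c = 0 -> (exists i, c i 0 < 0) ->
  0 <= \sum_j c j 0 ->
  pyramid `\` hull = \big[setU/set0]_(i | 0 < (- c) i 0) cell false E (- c) i.
Proof.
move=> Ec cneg sc; have Enc : E *m (- c) = 0 by rewrite mulmxN Ec oppr0.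
have cneg' : exists i, 0 < (- c) i 0 by case: cneg => i; exists i; rewrite mxE oppr_gt0.
apply/seteqP; split => y.
  move=> [[l [/= l0 l1] <-] nh]; apply/bigsetU_ex.
  have [t [i [t0 ci lti lt0 ltj]]] := slide_to_boundary cneg' l0.
  exists i => //; exists (l - t *: - c); last by rewrite mulmxBr -scalemxAr Enc scaler0 subr0.
  split => //=; rewrite ltNge; apply/negP => s1; apply: nh.
  have [s1'|s1'] := eqVneq (\sum_j l j 0) 1; first by exists l.
  have sl1 : \sum_j l j 0 < 1 by rewrite lt_neqAle s1'.
  set m := l - t *: - c in s1 lt0.
  have ms : \sum_j l j 0 < \sum_j m j 0 by exact: lt_le_trans s1.
  pose u := (1 - \sum_j l j 0) / (\sum_j m j 0 - \sum_j l j 0).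
  have d0 : 0 < \sum_j m j 0 - \sum_j l j 0 by rewrite subr_gt0.
  have u0 : 0 <= u by rewrite divr_ge0// ?subr_ge0// ltW.
  have u1 : u <= 1 by rewrite ler_pdivrMr// mul1r lerD2r.
  exists (l + u *: (m - l)); last first.
    have Em : E *m m = E *m l by rewrite mulmxBr -scalemxAr Enc scaler0 subr0.
    by rewrite mulmxDr -scalemxAr mulmxBr Em subrr scaler0 addr0.
  split => /=.
    move=> j; rewrite (_ : _ j 0 = (1 - u) * l j 0 + u * m j 0).
      by rewrite addr_ge0// mulr_ge0// subr_ge0.
    by rewrite [LHS]mxE [X in _ + X]mxE [X in _ * X]mxE [(- l) j 0]mxE; ring.
  transitivity (\sum_j l j 0 + u * (\sum_j m j 0 - \sum_j l j 0)).
    rewrite -sumrB mulr_sumr -big_split/=; apply: eq_bigr => j _.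
    by rewrite [LHS]mxE [X in _ + X]mxE [X in _ * X]mxE [(- l) j 0]mxE.
  by rewrite /u divfK ?gt_eqF// addrC subrK.
move=> /bigsetU_ex[i ci [l [l0 l1 li _] <-]]; split; first by exists l; split => //; exact: ltW.
move=> [m [/= m0 m1] /eqP]; rewrite -subr_eq0 -mulmxBr => /eqP Em.
have ci0 : c i 0 < 0 by move: ci; rewrite mxE oppr_gt0.
have := circuit_kernel Ec (ltr0_neq0 ci0) (Emin Ec (ltr0_neq0 ci0)) Em; set t := _ / _ => mlE.
have mE : m = l - (- t) *: c by rewrite scaleNr opprK -mlE addrC subrK.
have tle : t <= 0.
  by rewrite /t !mxE li subr0 mulr_ge0_le0// invr_le0 ltW.
move: m1; rewrite mE sumB => m1.
have : \sum_j l j 0 - (- t) * \sum_j c j 0 <= \sum_j l j 0.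
  by rewrite gerBl mulr_ge0// oppr_ge0.
by have {}l1 : \sum_j l j 0 < 1 := l1; rewrite m1 leNgt l1.
Qed.

(** The difference is computed as the volume of the part below the hull, so the
    hull, which may be a degenerate simplex, is never measured by itself. *)
Lemma subdiagram_volume_circuit_aux (c : 'cV[R]_k.+1) : E *m c = 0 ->
  (forall i, `|\det (col' i E)| = `|c i 0|) ->
  (exists i, 0 < c i 0) -> (exists i, c i 0 < 0) -> 0 <= \sum_j c j 0 ->
  (normalized_volume pyramid - normalized_volume hull)%E =
  (\sum_(i | c i 0 < 0) `|c i 0|)%:E.
Proof.
move=> Ec dE cp cn sc.
have [mT vT] := volume_cells true Ec; rewrite -pyramid_cells// in mT vT.
have Enc : E *m (- c) = 0 by rewrite mulmxN Ec oppr0.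
have [mL vL] := volume_cells false Enc; rewrite -pyramid_hull_cells// in mL vL.
have hp : hull `<=` pyramid by move=> _ [l [l0 l1] <-]; exists l => //; split; rewrite ?l1.
have hE : hull = pyramid `\` (pyramid `\` hull) by rewrite setDD setIidr.
have mH : borel hull by rewrite hE; exact: borelD.
have : lebesgue_volume pyramid = (lebesgue_volume hull + lebesgue_volume (pyramid `\` hull))%E.
  by rewrite -lebesgue_volumeU// ?setDUK// setDIK.
rewrite /normalized_volume vT vL.
have f0 : k`!%:R != 0 :> R by rewrite pnatr_eq0 -lt0n fact_gt0.
have -> : \sum_(i | 0 < (- c) i 0) `|\det (col' i E)| = \sum_(i | c i 0 < 0) `|c i 0|.
  by apply: eq_big => i; [rewrite mxE oppr_gt0|rewrite dE].
have := lebesgue_volume_ge0 hull.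
case: (lebesgue_volume hull) => [r _|_|//]; last by rewrite addye.
rewrite -EFinD => -[vE]; rewrite -!EFinM -EFinB; congr EFin.
by rewrite vE mulrDr addrC addKr mulrC divfK.
Qed.

End Circuit.

(** The volume of the part below the hull is carried by the side of the circuit
    on which the relation has the smaller total. *)
Lemma subdiagram_volume_circuit k (E : 'M[R]_(k, k.+1)) (c : 'cV[R]_k.+1) :
  E *m c = 0 -> (forall i, `|\det (col' i E)| = `|c i 0|) ->
  (exists i, 0 < c i 0) -> (exists i, c i 0 < 0) ->
  (normalized_volume (pyramid E) - normalized_volume (hull E))%E =
  (Num.min (\sum_(i | 0 < c i 0) `|c i 0|) (\sum_(i | c i 0 < 0) `|c i 0|))%:E.
Proof.
move=> Ec dE [ip cp] [im cm].
have sumc : \sum_i c i 0 = \sum_(i | 0 < c i 0) `|c i 0| - \sum_(i | c i 0 < 0) `|c i 0|.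
  rewrite (bigID (fun i => 0 < c i 0)) /=; congr (_ + _).
    by apply: eq_bigr => i ci; rewrite gtr0_norm.
  rewrite -sumrN [LHS](bigID (fun i => c i 0 < 0)) /= [X in _ + X]big1 ?addr0.
    apply: eq_big => i; first by case: ltgtP.
    by move=> /andP[_ ci]; rewrite ltr0_norm ?opprK.
  by move=> i; case: ltgtP.
have Emin (x : 'cV[R]_k.+1) i : E *m x = 0 -> x i 0 != 0 -> \det (col' i E) != 0.
  move=> Ex xi; rewrite -normr_eq0 dE normr_eq0.
  have dp : \det (col' ip E) != 0 by rewrite -normr_eq0 dE normr_eq0 gt_eqF.
  have := circuit_kernel Ec (lt0r_neq0 cp) dp Ex; set t := _ / _ => xE.
  by apply: contraNneq xi => ci; rewrite xE mxE ci mulr0.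
have [sc|sc] := leP 0 (\sum_i c i 0).
  rewrite (subdiagram_volume_circuit_aux Emin Ec dE)//; [|by exists ip|by exists im].
  by congr EFin; apply/esym/min_idPr; rewrite -subr_ge0 -sumc.
rewrite (@subdiagram_volume_circuit_aux _ _ Emin (- c)).
- under eq_bigl do rewrite mxE oppr_lt0.
  under eq_bigr do rewrite mxE normrN.
  by congr EFin; apply/esym/min_idPl; rewrite -subr_le0 -sumc ltW.
- by rewrite mulmxN Ec oppr0.
- by move=> i; rewrite dE mxE normrN.
- by exists im; rewrite mxE oppr_gt0.
- by exists ip; rewrite mxE oppr_lt0.
- by under eq_bigr do rewrite mxE; rewrite sumrN oppr_ge0 ltW.
Qed.

End CircuitVolume.

(** * Convex hulls, spans and lattices of faces *)

Section Spans.
Context {R : realType}.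

Lemma conv_hull_min (V : lmodType R) (S C : set V) : S `<=` C ->
  (forall x y (p : R), 0 <= p -> p <= 1 -> C x -> C y -> C (p *: x + (1 - p) *: y)) ->
  conv_hull S `<=` C.
Proof.
move=> SC Cc; apply: smallest_sub => // x y p; rewrite !inE => Cx Cy.
by apply: Cc.
Qed.

Lemma convex_conv_hull (V : lmodType R) (S : set V) x y (p : R) : 0 <= p -> p <= 1 ->
  conv_hull S x -> conv_hull S y -> conv_hull S (p *: x + (1 - p) *: y).
Proof.
move=> p0 p1 Sx Sy C [Cc SC].
have := Cc x y (Itv01 p0 p1); rewrite !inE; apply; [exact: Sx|exact: Sy].
Qed.

Lemma conv_hull_comb (V : lmodType R) (I : finType) (e : I -> V) (S : set V) (l : I -> R) :
  (forall i, conv_hull S (e i)) -> (forall i, 0 <= l i) -> \sum_i l i = 1 ->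
  conv_hull S (\sum_i l i *: e i).
Proof.
move=> Se; elim: (index_enum I) l => [|i s IH] l l0.
  by rewrite big_nil => /eqP; rewrite eq_sym oner_eq0.
rewrite !big_cons => s1.
have s0 : 0 <= \sum_(j <- s) l j by apply: sumr_ge0.
have li1 : l i <= 1 by rewrite -s1 lerDl.
have [l1|l1] := eqVneq (l i) 1.
  have /eqP : \sum_(j <- s) l j = 0 by apply: (addrI (l i)); rewrite s1 addr0 l1.
  rewrite psumr_eq0// => /allP sl0.
  rewrite big_seq big1 ?addr0 ?l1 ?scale1r// => j js.
  by have /eqP -> := sl0 _ js; rewrite scale0r.
have d0 : 0 < 1 - l i by rewrite subr_gt0 lt_neqAle l1.
have -> : \sum_(j <- s) l j *: e j = (1 - l i) *: \sum_(j <- s) (l j / (1 - l i)) *: e j.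
  rewrite scaler_sumr; apply: eq_bigr => j _.
  by rewrite scalerA mulrC divfK// gt_eqF.
apply: convex_conv_hull => //; apply: IH => [j|].
  by rewrite divr_ge0// ltW.
have sE : \sum_(j <- s) l j = 1 - l i by rewrite -s1 addrAC subrr add0r.
by rewrite -mulr_suml sE divff// gt_eqF.
Qed.

Lemma sub_conv_hull (V : lmodType R) (S : set V) : S `<=` conv_hull S.
Proof. exact: sub_smallest. Qed.

Lemma mulmx_sum_col (T : comPzRingType) m n (E : 'M[T]_(m, n)) (l : 'cV[T]_n) :
  E *m l = \sum_j l j 0 *: col j E.
Proof.
apply/colP => i; rewrite mxE summxE; apply: eq_bigr => j _.
by rewrite !mxE mulrC.
Qed.

Lemma conv_hull_columns m n (E : 'M[R]_(m, n)) :
  conv_hull (range (fun j => col j E)) =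
  [set E *m l | l in [set l : 'cV[R]_n | (forall j, 0 <= l j 0) /\ \sum_j l j 0 = 1]].
Proof.
apply/seteqP; split.
  apply: conv_hull_min => [_ [j _ <-]|_ _ p p0 p1 [l [/= l0 l1] <-] [k [/= k0 k1] <-]].
    exists (delta_mx j 0); last by rewrite colE.
    split => [i|]; first by rewrite mxE ler0n.
    rewrite (bigD1 j)//= mxE !eqxx big1 ?addr0// => i ij.
    by rewrite mxE (negbTE ij).
  exists (p *: l + (1 - p) *: k); last by rewrite mulmxDr -!scalemxAr.
  split => [i|] /=.
    by rewrite !mxE addr_ge0// mulr_ge0// subr_ge0.
  under eq_bigr do rewrite !mxE.
  by rewrite big_split /= -!mulr_sumr l1 k1 !mulr1 addrC subrK.
move=> _ [l [/= l0 l1] <-]; rewrite mulmx_sum_col.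
by apply: conv_hull_comb => // j; apply: sub_conv_hull; exists j.
Qed.

Lemma conv_hull_pyramid k (E : 'M[R]_(k, k.+1)) :
  conv_hull (0 |` range (fun j => col j E)) = pyramid E.
Proof.
apply/seteqP; split.
  apply: conv_hull_min => [_ [->|[j _ <-]]|_ _ p p0 p1 [l [/= l0 l1] <-] [m [/= m0 m1] <-]].
  - exists 0; last by rewrite mulmx0.
    by split => [j|]; rewrite ?mxE// big1 ?ler01// => j _; rewrite mxE.
  - exists (delta_mx j 0); last by rewrite colE.
    split => [i|]; first by rewrite mxE ler0n.
    rewrite (bigD1 j)//= mxE !eqxx big1 ?addr0// => i ij.
    by rewrite mxE (negbTE ij).
  - exists (p *: l + (1 - p) *: m); last by rewrite mulmxDr -!scalemxAr.
    split => [i|] /=; first by rewrite !mxE addr_ge0// mulr_ge0// subr_ge0.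
    under eq_bigr do rewrite !mxE.
    rewrite big_split /= -!mulr_sumr -[leRHS](subrK p) [leRHS]addrC.
    by rewrite lerD// ler_piMr// subr_ge0.
move=> _ [l [/= l0 l1] <-]; rewrite mulmx_sum_col.
pose e (i : 'I_k.+2) := if unlift ord0 i is Some j then col j E else 0.
pose w (i : 'I_k.+2) := if unlift ord0 i is Some j then l j 0 else 1 - \sum_j l j 0.
have -> : \sum_j l j 0 *: col j E = \sum_i w i *: e i.
  rewrite [RHS]big_ord_recl /e /w unlift_none scaler0 add0r.
  by apply: eq_bigr => j _; rewrite liftK.
apply: conv_hull_comb.
- move=> i; apply: sub_conv_hull; rewrite /e; case: unliftP => [j _|_]; last by left.
  by right; exists j.
- by move=> i; rewrite /w; case: unliftP => // _; rewrite subr_ge0.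
- rewrite [LHS]big_ord_recl /w unlift_none -[RHS](subrK (\sum_j l j 0)); congr (_ + _).
  by apply: eq_bigr => j _; rewrite liftK.
Qed.

Section Columns.
Context {d n : nat}.
Variable A : 'M[int]_(d, n).
Notation AR := (map_mx intr A : 'M[R]_(d, n)).
Implicit Types (F : set 'cV[R]_d).

Lemma columnE i : column A i = col i AR.
Proof. by apply/matrixP => j k; rewrite !mxE. Qed.

Lemma polytopeE : polytope A =
  [set AR *m l | l in [set l : 'cV[R]_n | (forall j, 0 <= l j 0) /\ \sum_j l j 0 = 1]].
Proof.
have e : column A = (fun j => col j AR) by apply/funext => j; rewrite columnE.
by rewrite /polytope -conv_hull_columns e.
Qed.

Definition supported (T : nmodType) F (x : 'cV[T]_n) : Prop :=
  forall i, i \in indices_off A F -> x i 0 = 0.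

Lemma in_indices_off F i : (i \in indices_off A F) = (column A i \notin F).
Proof. by rewrite inE. Qed.

Lemma notin_indices_off F i : i \notin indices_off A F <-> F (column A i).
Proof. by rewrite in_indices_off negbK inE. Qed.

(** What is used of a face: its supporting functional [u], [c] separates the
    columns on it from the others, and its points are affine combinations of
    its own columns. *)
Record face_functional F (u : 'rV[R]_d) (c : R) : Prop := FaceFunctional {
  face_le : forall i, (u *m column A i) 0 0 <= c;
  face_eq : forall i, i \notin indices_off A F -> (u *m column A i) 0 0 = c;
  face_lt : forall i, i \in indices_off A F -> (u *m column A i) 0 0 < c;
  face_comb : forall x, F x -> exists l : 'cV[R]_n,
    [/\ x = AR *m l, \sum_j l j 0 = 1 & supported F l];
  face_full : (forall i, i \notin indices_off A F) -> F = polytope A }.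

Lemma faceP F : is_face (polytope A) F -> exists u c, face_functional F u c.
Proof.
move=> [_ [u [c [uc FE]]]]; exists u, c.
have colP i : polytope A (column A i : 'cV[R]_d).
  by rewrite /polytope; apply: sub_conv_hull; exists i.
have lec i : (u *m column A i) 0 0 <= c by exact: uc.
have eqc i : i \notin indices_off A F -> (u *m column A i) 0 0 = c.
  by move=> /notin_indices_off; rewrite {1}FE => -[].
have ltc i : i \in indices_off A F -> (u *m column A i) 0 0 < c.
  move=> iF; rewrite lt_neqAle lec andbT; apply: contraTneq iF => e.
  by apply/notin_indices_off; rewrite FE.
have uA (l : 'cV[R]_n) : (u *m (AR *m l)) 0 0 = \sum_j l j 0 * (u *m column A j) 0 0.
  rewrite (mulmx_sum_col AR l) mulmx_sumr summxE; apply: eq_bigr => j _.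
  by rewrite -scalemxAr columnE mxE.
split => //.
  move=> x; rewrite {1}FE polytopeE => -[[l [/= l0 l1] <-]] ulc.
  (* On the supporting hyperplane no weight is left for a column off the face. *)
  exists l; split => // i iF.
  have : \sum_j l j 0 * (c - (u *m column A j) 0 0) = 0.
    under eq_bigr do rewrite mulrBr; rewrite sumrB -mulr_suml l1 mul1r -uA ulc subrr //.
  move=> /eqP; rewrite psumr_eq0 => [/allP /(_ i)|j _]; last by rewrite mulr_ge0// subr_ge0.
  rewrite mem_index_enum => /(_ isT); rewrite mulf_eq0 subr_eq0 => /orP[/eqP//|].
  by rewrite gt_eqF// ltc.
move=> allF; rewrite FE; apply/seteqP; split => [x []//|x Px]; split => //.
move: Px; rewrite polytopeE => -[l [/= l0 l1] <-].
rewrite uA; under eq_bigr do rewrite (eqc _ (allF _)).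
by rewrite -mulr_suml l1 mul1r.
Qed.

Lemma face_nonempty F u c : face_functional F u c -> F !=set0 ->
  exists i, F (column A i).
Proof.
move=> fF [x /(face_comb fF)[l [_ l1 ls]]]; apply: contrapT => nF.
have : \sum_j l j 0 = 0.
  apply: big1 => j _; apply: ls; rewrite in_indices_off; apply/negP => /set_mem Fj.
  by apply: nF; exists j.
by rewrite l1 => /eqP; rewrite oner_eq0.
Qed.

Lemma proper_face_off F u c : face_functional F u c -> F <> polytope A ->
  exists i, i \in indices_off A F.
Proof.
move=> fF nP; apply: contrapT => nI; apply: nP; apply: (face_full fF) => i.
by apply/negP => iF; apply: nI; exists i.
Qed.

Lemma supported_delta (T : pzSemiRingType) F i : F (column A i) ->
  supported F (delta_mx i 0 : 'cV[T]_n).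
Proof.
move=> Fi j jF; rewrite mxE; case: eqP jF => // -> ; rewrite in_indices_off.
by rewrite mem_set.
Qed.

Lemma lin_span_face F u c : face_functional F u c ->
  lin_span F = [set AR *m x | x in supported F].
Proof.
move=> fF; apply/seteqP; split.
  apply: smallest_sub => [|x /(face_comb fF)[l [-> _ ls]]]; last by exists l.
  split => [|a _ _ [x xs <-] [y ys <-]].
    by exists 0; [move=> i _; rewrite mxE | rewrite mulmx0].
  exists (a *: x + y); last by rewrite mulmxDr -scalemxAr.
  by move=> i iF; rewrite !mxE xs// ys// mulr0 addr0.
move=> _ [x xs <-] W [[W0 Wl] FW].
rewrite mulmx_sum_col; elim/big_rec: _ => // i y _ Wy.
have [iF|/notin_indices_off Fi] := boolP (i \in indices_off A F).
  by rewrite xs// scale0r add0r.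
by apply: Wl => //; rewrite -columnE; exact: FW.
Qed.

Lemma latticeE F : lattice_of A F =
  [set AR *m map_mx intr z | z in [set z : 'cV[int]_n | supported F z]].
Proof.
apply/seteqP; split.
  apply: smallest_sub.
    split; first by exists 0; [move=> i _; rewrite mxE|rewrite map_mx0 mulmx0].
    move=> _ _ [x xs <-] [y ys <-]; exists (x - y); last by rewrite map_mxB mulmxBr.
    by move=> i iF; rewrite !mxE xs// ys// subr0.
  move=> _ [[i _ <-] Fi]; exists (delta_mx i 0); first exact: supported_delta.
  by rewrite map_delta_mx columnE colE.
move=> _ [z zs <-] G [[G0 GB] FG].
have GN x : G x -> G (- x) by rewrite -sub0r; exact: GB.
have GD x y : G x -> G y -> G (x + y).
  by move=> Gx Gy; rewrite -[y]opprK; apply: GB => //; exact: GN.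
have Gn x m : G x -> G (x *+ m) by move=> Gx; elim: m => // m IH; rewrite mulrS; exact: GD.
rewrite mulmx_sum_col; elim/big_rec: _ => // i y _ Gy; apply: GD => //.
have [iF|/notin_indices_off Fi] := boolP (i \in indices_off A F).
  by rewrite mxE zs// scale0r.
have Gi : G (column A i) by apply: FG; split => //; exists i.
rewrite mxE -columnE scaler_int; case: (z i 0) => m; first exact: Gn.
by rewrite NegzE mulrNz; apply/GN/Gn.
Qed.

End Columns.
End Spans.

(** * Linear relations among the columns *)

Section GaleRelations.
Context {R : realType}.

Lemma primitive_bezout (v : 'rV[int]_2) : primitive_vector v ->
  exists a b : int, a * v 0 0 + b * v 0 1 = 1.
Proof.
move=> pv; have [a [b abE]] := Bezoutz (v 0 0) (v 0 1).
exists a, b; rewrite abE; set g := gcdz _ _ in abE *.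
pose w : 'rV[int]_2 := \row_j divz (v 0 j) g.
have vE : v = g *: w.
  apply/rowP => j; rewrite !mxE mulrC divzK//.
  by case: j => -[|[|//]] h; [rewrite (_ : Ordinal h = 0)|rewrite (_ : Ordinal h = 1)];
    rewrite ?dvdz_gcdl ?dvdz_gcdr//; exact/val_inj.
by case: (pv _ _ vE) => // gN; have : 0 <= g by []; rewrite gN.
Qed.

(** With this choice of orthogonal vector, [B *m orth v] is the vector of the
    determinants [gale_det v B]. *)
Definition orth (T : pzRingType) (v : 'rV[T]_2) : 'cV[T]_2 :=
  \col_i if i == 0 then - v 0 1 else v 0 0.

Lemma gale_detE n (B : 'M[int]_(n, 2)) v i : gale_det v B i = (B *m orth v) i 0.
Proof.
have det2 (M : 'M[int]_2) : \det M = M 0 0 * M 1 1 - M 0 1 * M 1 0.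
  rewrite (expand_det_row _ 0) !big_ord_recl big_ord0 addr0 /cofactor !det_mx11 !mxE.
  rewrite /= expr0 expr1 mul1r mulN1r mulrN.
  by congr (M _ _ * M _ _ - M _ _ * M _ _); exact/val_inj.
rewrite /gale_det det2.
have e0 : (0 : 'I_2) = lshift 1 (0 : 'I_1) by exact/val_inj.
have e1 : (1 : 'I_2) = rshift 1 (0 : 'I_1) by exact/val_inj.
have u j : (col_mx v (row i B) : 'M[int]_2) 0 j = v 0 j by rewrite {1}e0 (@col_mxEu _ 1 1).
have l j : (col_mx v (row i B) : 'M[int]_2) 1 j = B i j by rewrite {1}e1 (@col_mxEd _ 1 1) mxE.
rewrite !u !l mxE !big_ord_recl big_ord0 addr0 !mxE /=.
by rewrite (_ : lift _ _ = 1); [ring|exact/val_inj].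
Qed.

Lemma orth_line (T : comPzRingType) (v : 'rV[T]_2) (a b : T) (y : 'cV[T]_2) :
  a * v 0 0 + b * v 0 1 = 1 -> v 0 0 * y 0 0 + v 0 1 * y 1 0 = 0 ->
  y = (a * y 1 0 - b * y 0 0) *: orth v.
Proof.
move=> ab vy; apply/colP => -[[|[|//]] h].
  rewrite (_ : Ordinal h = 0); last exact/val_inj.
  rewrite !mxE /=.
  transitivity ((a * v 0 0 + b * v 0 1) * y 0 0 - a * (v 0 0 * y 0 0 + v 0 1 * y 1 0)).
    by rewrite ab vy; ring.
  by ring.
rewrite (_ : Ordinal h = 1); last exact/val_inj.
rewrite !mxE /=.
transitivity ((a * v 0 0 + b * v 0 1) * y 1 0 - b * (v 0 0 * y 0 0 + v 0 1 * y 1 0)).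
  by rewrite ab vy; ring.
by ring.
Qed.

Context {d n : nat}.
Variables (A : 'M[int]_(d, n)) (B : 'M[int]_(n, 2)).
Hypothesis AB : gale_dual A B.
Notation AR := (map_mx intr A : 'M[R]_(d, n)).
Notation BR := (map_mx intr B : 'M[R]_(n, 2)).

Lemma intr_inj_mx (F : numFieldType) m p : injective (map_mx intr : 'M[int]_(m, p) -> 'M[F]_(m, p)).
Proof.
by move=> X Y /matrixP XY; apply/matrixP => i j; have := XY i j; rewrite !mxE => /intr_inj.
Qed.

Lemma integral_multiple p (x : 'cV[rat]_p) :
  exists N : int, N != 0 /\ exists z : 'cV[int]_p, N%:~R *: x = map_mx intr z.
Proof.
exists (\prod_i denq (x i 0)); split.
  by apply/prodf_neq0 => i _; exact: denq_neq0.
exists (\col_i (numq (x i 0) * \prod_(j | j != i) denq (x j 0))).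
apply/colP => i; rewrite !mxE (bigD1 i)//= !intrM mulrAC; congr (_ * _).
by rewrite numqE mulrC.
Qed.

(** Clearing denominators turns a rational relation into an integral one, which
    the Gale dual describes. *)
Lemma rat_kernel :
  (kermx (map_mx intr A : 'M[rat]_(d, n))^T <= (map_mx intr B : 'M[rat]_(n, 2))^T)%MS.
Proof.
apply/row_subP => i; set K := kermx _.
have [N [N0 [z zE]]] := integral_multiple (row i K)^T.
have Az : A *m z = 0.
  apply: (@intr_inj_mx rat); rewrite map_mxM -zE -scalemxAr map_mx0.
  apply: trmx_inj; rewrite linearZ /= trmx_mul trmxK trmx0 -row_mul mulmx_ker.
  by rewrite row0 scaler0.
have [y [zy _]] := (AB.2 z Az).
have NQ : (N%:~R : rat) != 0 by rewrite intr_eq0.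
have -> : row i K = N%:~R^-1 *: ((map_mx intr y)^T *m (map_mx intr B : 'M[rat]_(n, 2))^T).
  rewrite -trmx_mul -map_mxM -zy -zE linearZ /= trmxK scalerA mulVf// scale1r //.
by rewrite scalemx_sub// submxMl.
Qed.

(** Kernels commute with the extension of scalars from the rationals. *)
Lemma real_kernel (x : 'cV[R]_n) : AR *m x = 0 -> exists y : 'cV[R]_2, x = BR *m y.
Proof.
move=> Ax.
have mapQ p q (M : 'M[int]_(p, q)) : map_mx (ratr : rat -> R) (map_mx intr M) = map_mx intr M.
  by apply/matrixP => i j; rewrite !mxE ratr_int.
have : (x^T <= kermx AR^T)%MS by apply/sub_kermxP; rewrite -trmx_mul Ax trmx0.
rewrite -mapQ matrix.map_trmx -map_kermx => xK.
have := rat_kernel; rewrite -(map_submx (ratr : {rmorphism rat -> R})) => KB.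
have := submx_trans xK KB; rewrite -matrix.map_trmx mapQ => /submxP[y yE].
by exists y^T; apply: trmx_inj; rewrite trmx_mul trmxK.
Qed.

Section OnLine.
Variables (v : 'rV[int]_2) (i0 : 'I_n).
Hypotheses (pv : primitive_vector v) (b0 : row i0 B != 0) (g0 : gale_det v B i0 = 0).
Let gamma := B *m orth v.

Lemma row_on_line : exists s : int, s != 0 /\ row i0 B = s *: v.
Proof.
have [a [b ab]] := primitive_bezout pv.
have dE : - B i0 0 * v 0 1 + B i0 1 * v 0 0 = 0.
  move: g0; rewrite gale_detE mxE !big_ord_recl big_ord0 addr0 !mxE /= => <-.
  by rewrite (_ : lift _ _ = 1) ?mulNr ?mulrN//; exact/val_inj.
have bE : row i0 B = (a * B i0 0 + b * B i0 1) *: v.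
  apply/rowP => -[[|[|//]] h].
    rewrite (_ : Ordinal h = 0); last exact/val_inj.
    rewrite !mxE.
    transitivity ((a * v 0 0 + b * v 0 1) * B i0 0 + b * (- B i0 0 * v 0 1 + B i0 1 * v 0 0)).
      by rewrite ab dE; ring.
    by ring.
  rewrite (_ : Ordinal h = 1); last exact/val_inj.
  rewrite !mxE.
  transitivity ((a * v 0 0 + b * v 0 1) * B i0 1 - a * (- B i0 0 * v 0 1 + B i0 1 * v 0 0)).
    by rewrite ab dE; ring.
  by ring.
exists (a * B i0 0 + b * B i0 1); split => //.
by apply: contraNneq b0 => s0; rewrite bE s0 scale0r.
Qed.

(** A relation [B *m y] that vanishes at an index whose row spans the line of [v]
    has [y] orthogonal to [v]. *)
Lemma int_relation (z : 'cV[int]_n) : A *m z = 0 -> z i0 0 = 0 ->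
  exists t : int, z = t *: gamma.
Proof.
move=> /AB.2[y [zy _]] z0; have [a [b ab]] := primitive_bezout pv.
have [s [s0 bE]] := row_on_line.
have vy : v 0 0 * y 0 0 + v 0 1 * y 1 0 = 0.
  apply: (mulfI s0); rewrite mulr0 -z0 zy mxE !big_ord_recl big_ord0 addr0.
  have bj j : B i0 j = s * v 0 j by move/rowP: bE => /(_ j); rewrite !mxE.
  by rewrite (_ : lift _ _ = 1) ?bj; [ring|exact/val_inj].
by exists (a * y 1 0 - b * y 0 0); rewrite zy {1}(orth_line ab vy) -scalemxAr.
Qed.

Lemma real_relation (x : 'cV[R]_n) : AR *m x = 0 -> x i0 0 = 0 ->
  exists t : R, x = t *: map_mx intr gamma.
Proof.
move=> /real_kernel[y xy] x0; have [a [b ab]] := primitive_bezout pv.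
have [s [s0 bE]] := row_on_line.
pose vR : 'rV[R]_2 := map_mx intr v.
have sR : (s%:~R : R) != 0 by rewrite intr_eq0.
have vy : vR 0 0 * y 0 0 + vR 0 1 * y 1 0 = 0.
  apply: (mulfI sR); rewrite mulr0 -x0 xy [RHS]mxE !big_ord_recl big_ord0 addr0.
  have bj j : BR i0 j = s%:~R * vR 0 j.
    by move/rowP: bE => /(_ j); rewrite !mxE => ->; rewrite intrM.
  by rewrite (_ : lift _ _ = 1) ?bj; [ring|exact/val_inj].
have abR : a%:~R * vR 0 0 + b%:~R * vR 0 1 = 1 by rewrite !mxE -!intrM -intrD ab.
exists (a%:~R * y 1 0 - b%:~R * y 0 0); rewrite /gamma xy {1}(orth_line abR vy) -scalemxAr map_mxM.
congr (_ *: (_ *m _)); apply/colP => j; rewrite !mxE; case: ifP => // _.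
by rewrite rmorphN.
Qed.

Lemma gamma_relation : A *m gamma = 0.
Proof. by rewrite mulmxA AB.1 mul0mx. Qed.

End OnLine.

(** Both the rows of [A] and the constant row pair to zero with a relation. *)
Lemma affine_relation_sum (u : 'rV[R]_d) (c : R) (z : 'cV[int]_n) : A *m z = 0 ->
  ((const_mx 1 : 'rV[rat]_n) <= (map_mx intr A : 'M[rat]_(d, n)))%MS ->
  \sum_i (c - (u *m column A i) 0 0) * (z i 0)%:~R = 0.
Proof.
move=> Az /submxP[D oneE].
have sz : \sum_i z i 0 = 0.
  apply: (@intr_inj rat); rewrite rmorph0 rmorph_sum /=.
  have : (const_mx 1 : 'rV[rat]_n) *m map_mx intr z = 0.
    by rewrite oneE -mulmxA -map_mxM Az map_mx0 mulmx0.
  move=> /matrixP/(_ 0 0); rewrite !mxE => e.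
  by rewrite -[RHS]e; apply: eq_bigr => i _; rewrite !mxE mul1r.
under eq_bigr do rewrite mulrBl; rewrite sumrB -mulr_sumr -rmorph_sum /= sz rmorph0 mulr0 sub0r.
apply/eqP; rewrite oppr_eq0; apply/eqP.
transitivity ((u *m (AR *m map_mx intr z)) 0 0); last by rewrite -map_mxM Az map_mx0 mulmx0 mxE.
rewrite (mulmx_sum_col AR) mulmx_sumr summxE; apply: eq_bigr => j _.
by rewrite -scalemxAr columnE !mxE mulrC.
Qed.

(** The supporting functional of a face weights the entries off the face with one
    sign, so these entries cannot all be nonpositive. *)
Lemma face_relation_signs F u c (z : 'cV[int]_n) : A *m z = 0 ->
  ((const_mx 1 : 'rV[rat]_n) <= (map_mx intr A : 'M[rat]_(d, n)))%MS ->
  @face_functional R d n A F u c ->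
  (exists2 i, i \in indices_off A F & z i 0 != 0) ->
  exists2 i, i \in indices_off A F & 0 < z i 0.
Proof.
move=> Az one fF [i iF zi]; apply: contrapT => npos.
have le0 j : j \in indices_off A F -> z j 0 <= 0.
  by move=> jF; rewrite leNgt; apply/negP => zj; apply: npos; exists j.
have := affine_relation_sum u c Az one => /eqP; rewrite -oppr_eq0 -sumrN psumr_eq0.
  move=> /allP/(_ i); rewrite mem_index_enum => /(_ isT).
  rewrite oppr_eq0 mulf_eq0 intr_eq0 (negbTE zi) orbF subr_eq0 => /eqP cE.
  by have := face_lt fF iF; rewrite -cE ltxx.
move=> j _; rewrite -mulrN; have [jF|jF] := boolP (j \in indices_off A F).
  by rewrite mulr_ge0// ?subr_ge0 ?(face_le fF)// oppr_ge0 lerz0 le0.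
by rewrite (face_eq fF jF) subrr mul0r.
Qed.

End GaleRelations.

(** * Circuits in a lattice *)

Section IntegralCircuits.

Section Minors.
Context {k m : nat}.
Variables (E : 'M[int]_(k, m)) (c : 'cV[int]_m) (r : 'rV[int]_m).
Hypotheses (rc : r *m c = 1%:M) (Ec : E *m c = 0)
  (Esurj : forall w : 'cV[int]_k, exists x, E *m x = w)
  (Eker : forall x : 'cV[int]_m, E *m x = 0 -> exists s : int, x = s *: c).

(** A section of [E] and the relation [c] are inverse to [E] completed by a row
    on which [c] takes the value 1. *)
Lemma circuit_section : exists Z : 'M[int]_(m, k),
  col_mx r E *m row_mx c Z = 1%:M /\ row_mx c Z *m col_mx r E = 1%:M.
Proof.
have [f fE] := choice (fun j : 'I_k => Esurj (delta_mx j 0)).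
pose Z0 := \matrix_(i, j) f j i 0.
have EZ0 : E *m Z0 = 1%:M.
  apply/matrixP => i j; rewrite !mxE.
  have := congr1 (fun M : 'cV_k => M i 0) (fE j); rewrite !mxE andbT => <-.
  by apply: eq_bigr => l _; rewrite mxE.
pose Z := Z0 - c *m (r *m Z0).
have EZ : E *m Z = 1%:M by rewrite mulmxBr EZ0 [E *m (c *m _)]mulmxA Ec mul0mx subr0.
have rZ : r *m Z = 0 by rewrite mulmxBr [r *m (c *m _)]mulmxA rc mul1mx subrr.
have EX : E *m (1%:M - Z *m E) = 0 by rewrite mulmxBr mulmx1 [E *m (Z *m _)]mulmxA EZ mul1mx subrr.
have ker j : exists s, col j (1%:M - Z *m E) = s *: c.
  by apply: Eker; rewrite colE mulmxA EX mul0mx.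
have [s sE] := choice ker.
have XE : 1%:M - Z *m E = c *m \row_j s j.
  apply/matrixP => i j; have := congr1 (fun M : 'cV_m => M i 0) (sE j).
  by rewrite !mxE big_ord1 !mxE mulrC.
have sr : \row_j s j = r.
  rewrite -[LHS]mul1mx -rc -mulmxA -XE mulmxBr mulmx1 [r *m (Z *m _)]mulmxA rZ mul0mx subr0 //.
exists Z; split; last by rewrite mul_row_col -sr -XE subrK.
by rewrite mul_col_row rc rZ Ec EZ -scalar_mx_block.
Qed.

Lemma circuit_size : m = k.+1.
Proof.
have [Z [WV VW]] := circuit_section.
by apply/eqP; rewrite eqn_leq (mulmx1_min VW) (mulmx1_min WV).
Qed.

End Minors.

(** The completed matrix is unimodular, and [c] is a column of its inverse, that
    is, up to sign, of its adjugate; the cofactors in question are the minors. *)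
Lemma circuit_minors k (E : 'M[int]_(k, k.+1)) (c : 'cV[int]_k.+1) (r : 'rV[int]_k.+1) :
  r *m c = 1%:M -> E *m c = 0 ->
  (forall w : 'cV[int]_k, exists x, E *m x = w) ->
  (forall x : 'cV[int]_k.+1, E *m x = 0 -> exists s : int, x = s *: c) ->
  forall i, `|\det (col' i E)| = `|c i 0|.
Proof.
move=> rc Ec Es Ek i; have [Z [WV VW]] := circuit_section rc Ec Es Ek.
pose W : 'M[int]_k.+1 := col_mx r E; pose V : 'M[int]_k.+1 := row_mx c Z.
have adjE : \adj W = \det W *: V.
  by rewrite -[LHS]mul1mx -[1%:M]VW -mulmxA mul_mx_adj mul_mx_scalar.
have dW : `|\det W| = 1.
  have := congr1 (fun M : 'M[int]_k.+1 => absz (\det M)) WV; rewrite -/W -/V det_mulmx det1 abszM.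
  by move=> /eqP; rewrite muln_eq1 => /andP[/eqP dW _]; rewrite -abszE dW.
have Vi : V i 0 = c i 0.
  by rewrite -[RHS](@row_mxEl _ _ 1 k c Z); congr (V i _); apply: val_inj.
have := congr1 (fun M : 'M[int]_k.+1 => M i 0) adjE; rewrite [LHS]mxE [RHS]mxE Vi /cofactor.
rewrite (_ : row' 0 (col' i W) = col' i E) => [/(congr1 Num.norm)|].
  by rewrite !normrM dW mul1r normrX normrN1 expr1n mul1r.
apply/matrixP => a b; rewrite [LHS]mxE [LHS]mxE [RHS]mxE -[RHS](@col_mxEd _ 1 k _ r).
by congr (W _ _); apply: val_inj.
Qed.

(** The Smith normal form extends a primitive vector to a basis; the coordinates
    on the remaining basis vectors give the quotient map. *)
Lemma primitive_quotient m (c : 'cV[int]_m) (r : 'rV[int]_m) : r *m c = 1%:M ->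
  exists k (N : 'M[int]_(k, m)), [/\ N *m c = 0,
    forall w : 'cV[int]_k, exists x, N *m x = w &
    forall x : 'cV[int]_m, N *m x = 0 -> exists s : int, x = s *: c].
Proof.
case: m c r => [|k] c r rc.
  by have := congr1 (fun M : 'M[int]_1 => M 0 0) rc; rewrite flatmx0 mulmx0 !mxE.
exists k.
have [L uL [Q _ [dd _ cE]]] := int_Smith_normal_form c.
pose L' : 'M[int]_(k.+1, 1 + k) := L.
pose l := lsubmx L'; pose Z := rsubmx L'.
pose e := dd`_0 * Q 0 0.
have {}cE : c = e *: l.
  rewrite cE -mulmxA; apply/colP => i; rewrite !mxE /= big_ord_recl big1 ?addr0.
    rewrite !mxE big_ord1 !mxE /= mulr1n mulrC; congr (_ * L _ _); exact/val_inj.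
  by move=> j _; rewrite !mxE big_ord1 !mxE /= mul0r mulr0.
have er : e * (r *m l) 0 0 = 1.
  have := congr1 (fun M : 'M[int]_1 => M 0 0) rc; rewrite cE -scalemxAr mxE => ->.
  by rewrite mxE eqxx.
have lE : l = (r *m l) 0 0 *: c by rewrite cE scalerA mulrC er scale1r.
pose N := dsubmx (invmx L : 'M[int]_(1 + k, k.+1)).
have NL : invmx L *m L' = 1%:M by rewrite mulVmx.
have LE : L' = row_mx l Z by rewrite hsubmxK.
have NE : N *m row_mx l Z = row_mx 0 1%:M.
  by rewrite -LE mul_dsub_mx NL [X in dsubmx X](@scalar_mx_block _ 1 k) col_mxKd.
move: NE; rewrite mul_mx_row => /eq_row_mx[Nl NZ].
exists N; split.
- by rewrite cE -scalemxAr Nl scaler0.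
- by move=> w; exists (Z *m w); rewrite mulmxA NZ mul1mx.
- move=> x Nx; set u := usubmx (invmx L *m x : 'cV[int]_(1 + k)).
  have xE : x = l *m u.
    have Lx : invmx L *m x = col_mx u 0.
      by rewrite -[LHS](@vsubmxK _ 1 k) -/u -mul_dsub_mx -/N Nx.
    transitivity (row_mx l Z *m col_mx u 0); last by rewrite mul_row_col mulmx0 addr0.
    by rewrite -LE -Lx; exact: esym (mulKVmx uL x).
  exists ((u 0 0) * (r *m l) 0 0).
  by rewrite -scalerA -lE xE [u]mx11_scalar mul_mx_scalar !mxE eqxx mulr1n.
Qed.

Lemma volume_lattice_circuit (R : realType) k m (E : 'M[int]_(k, m)) (c : 'cV[int]_m)
    (r : 'rV[int]_m) (ER := map_mx intr E : 'M[R]_(k, m)) :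
  r *m c = 1%:M -> E *m c = 0 ->
  (forall w : 'cV[int]_k, exists x, E *m x = w) ->
  (forall x : 'cV[int]_m, E *m x = 0 -> exists s : int, x = s *: c) ->
  (exists j, 0 < c j 0) -> (exists j, c j 0 < 0) ->
  (normalized_volume (conv_hull (0%R |` range (fun j => col j ER)))
   - normalized_volume (conv_hull (range (fun j => col j ER))))%E =
  ((Num.min (\sum_(j | (0 : int) < c j 0) `|c j 0|)
            (\sum_(j | c j 0 < (0 : int)) `|c j 0|))%:~R : R)%:E.
Proof.
move=> rc Ec Es Ek; have mE := circuit_size rc Ec Es Ek.
subst m; move=> [jp cp] [jm cm].
rewrite conv_hull_pyramid conv_hull_columns -/(hull ER).
pose cR : 'cV[R]_k.+1 := map_mx intr c.
have cRE j : cR j 0 = (c j 0)%:~R by rewrite mxE.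
rewrite (@subdiagram_volume_circuit _ _ ER cR).
- have pE : \sum_(i | 0 < cR i 0) `|cR i 0| = (\sum_(j | (0 : int) < c j 0) `|c j 0|)%:~R.
    by rewrite rmorph_sum; apply: eq_big => j /=; rewrite cRE ?ltr0z// intr_norm.
  have nE : \sum_(i | cR i 0 < 0) `|cR i 0| = (\sum_(j | c j 0 < (0 : int)) `|c j 0|)%:~R.
    by rewrite rmorph_sum; apply: eq_big => j /=; rewrite cRE ?ltrz0// intr_norm.
  rewrite pE nE; congr EFin; rewrite !minEle ler_int.
  by case: ifP.
- by rewrite -map_mxM Ec map_mx0.
- by move=> i; rewrite cRE -intr_norm -(circuit_minors rc Ec Es Ek) -map_col' det_map_mx intr_norm.
- by exists jp; rewrite cRE ltr0z.
- by exists jm; rewrite cRE ltrz0.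
Qed.

Lemma bezout_big (I : finType) (P : pred I) (f : I -> int) :
  exists r : I -> int,
    \sum_(i | P i) r i * f i = (\big[gcdn/0%N]_(i | P i) `|f i|%N)%:Z.
Proof.
elim: (index_enum I) (index_enum_uniq I) => [_|i s IH /= /andP[si us]].
  by exists (fun=> 0); rewrite !big_nil.
have [r rE] := IH us; rewrite !big_cons; case: ifPn => [Pi|nPi]; last first.
  by exists r; rewrite !big_cons (negbTE nPi).
set G := \big[gcdn/0%N]_(j <- s | P j) `|f j|%N in rE *.
have [u [w uw]] := Bezoutz (f i) G%:Z.
exists (fun j => if j == i then u else w * r j); rewrite big_cons Pi eqxx.
transitivity (u * f i + w * G%:Z); last by rewrite uw /gcdz.
rewrite -rE mulr_sumr; congr (_ + _).
rewrite big_seq_cond [RHS]big_seq_cond; apply: eq_bigr => j /andP[js _].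
by rewrite ifN ?mulrA//; apply: contraNneq si => <-.
Qed.

End IntegralCircuits.

(** * A pair of faces with a single relation *)

(** [gamma] generates the relations among the columns on [alpha], over the integers
    and over the reals, and takes both signs off [beta]. From here on neither the
    Gale dual nor the relevant line intervenes. *)
Section FacePair.
Context {R : realType} {d n : nat}.
Variables (A : 'M[int]_(d, n)) (alpha beta : set 'cV[R]_d) (gamma : 'cV[int]_n).
Notation AR := (map_mx intr A : 'M[R]_(d, n)).
Notation Ia := (indices_off A alpha).
Notation Ib := (indices_off A beta).
Hypotheses (Iab : Ia \subset Ib) (gamma_alpha : supported A alpha gamma)
  (Agamma : A *m gamma = 0)
  (relR : forall x : 'cV[R]_n, AR *m x = 0 -> supported A alpha x ->
     exists t : R, x = t *: map_mx intr gamma)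
  (relZ : forall z : 'cV[int]_n, A *m z = 0 -> supported A alpha z ->
     exists t : int, z = t *: gamma)
  (gamma_pos : exists2 i, i \in Ib & 0 < gamma i 0)
  (gamma_neg : exists2 i, i \in Ib & gamma i 0 < 0)
  (span_beta : lin_span beta = [set AR *m x | x in supported A beta]).

Let g := \big[gcdn/0%N]_(i in Ib) absz (gamma i 0).
Let c i := divz (gamma i 0) g%:Z.

Lemma gcd_gt0 : (0 < g)%N.
Proof.
have [i iI gi] := gamma_pos; rewrite lt0n; apply/eqP => g0.
have : gamma i 0 \in dvdz g%:Z by rewrite dvdzE /= /g (bigD1 i)//= dvdn_gcdl.
by rewrite g0 dvd0z gt_eqF.
Qed.

Lemma gamma_gc i : i \in Ib -> gamma i 0 = c i * g%:Z.
Proof.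
by move=> iI; rewrite /c divzK// dvdzE /= /g (bigD1 i)//= dvdn_gcdl.
Qed.

Lemma c_alpha i : i \in Ia -> c i = 0.
Proof. by move=> iI; rewrite /c gamma_alpha// div0z. Qed.

Lemma c_bezout : exists r : 'I_n -> int, \sum_(i in Ib) r i * c i = 1.
Proof.
have [r rE] := bezout_big (fun i => i \in Ib) (fun i => gamma i 0).
exists r; have g0 : g%:Z != 0 by rewrite eqz_nat -lt0n gcd_gt0.
apply: (mulIf g0); rewrite mul1r mulr_suml -[RHS]rE; apply: eq_bigr => i iI.
by rewrite (gamma_gc iI) mulrA.
Qed.

Lemma AR_int (z : 'cV[int]_n) : A *m z = 0 <-> AR *m map_mx intr z = 0.
Proof.
rewrite -map_mxM; split=> [->|]; first by rewrite map_mx0.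
by rewrite -(map_mx0 (intr : int -> R)) => /intr_inj_mx.
Qed.

Lemma supported_beta_alpha (T : nmodType) (x : 'cV[T]_n) :
  supported A beta x -> supported A alpha x.
Proof. by move=> xs i iI; apply: xs; exact: (fintype.subsetP Iab). Qed.

(** Modulo the columns on [beta], a point of the span is a real multiple of the
    relation; as [c] is primitive, integrality of the multiple of [c] follows. *)
Lemma in_span_beta (z : 'cV[int]_n) : supported A alpha z ->
  lin_span beta (AR *m map_mx intr z) <->
  exists s : int, forall i, i \in Ib -> z i 0 = s * c i.
Proof.
move=> zs; rewrite span_beta; have gR : (g%:R : R) != 0 by rewrite pnatr_eq0 -lt0n gcd_gt0.
split.
  move=> [x xs xz].
  have : AR *m (map_mx intr z - x) = 0 by rewrite mulmxBr xz subrr.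
  move=> /relR[|t tE]; first by move=> i iI; rewrite !mxE zs// (supported_beta_alpha xs)// subrr.
  have [r rE] := c_bezout; exists (\sum_(j in Ib) r j * z j 0).
  have zt i : i \in Ib -> (z i 0)%:~R = t * g%:R * (c i)%:~R :> R.
    move=> iI; have /colP/(_ i) := tE; rewrite !mxE xs// subr0 => ->.
    by rewrite (gamma_gc iI) intrM; ring.
  have sE : (\sum_(j in Ib) r j * z j 0)%:~R = t * g%:R :> R.
    have rR : \sum_(i in Ib) (r i * c i)%:~R = 1 :> R by rewrite -rmorph_sum /= rE.
    rewrite rmorph_sum /= -[RHS]mulr1 -[X in _ = _ * X]rR mulr_sumr.
    by apply: eq_bigr => i iI; rewrite !intrM zt//; ring.
  by move=> i iI; apply: (@intr_inj R); rewrite zt// intrM sE.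
move=> [s sE]; exists (map_mx intr z - (s%:~R / g%:R) *: map_mx intr gamma).
  by move=> i iI; rewrite !mxE sE// (gamma_gc iI) !intrM; field.
have -> : AR *m (map_mx intr z - (s%:~R / g%:R) *: map_mx intr gamma) = AR *m map_mx intr z.
  by rewrite mulmxBr -scalemxAr; have [->] := AR_int gamma; rewrite // scaler0 subr0.
by [].
Qed.

(** The class of this combination generates the torsion of the quotient of the
    two lattices; its order is [g]. *)
Let omega : 'cV[int]_n := \col_i if i \in Ib then c i else 0.
Let H := lattice_of A beta.
Let pt (z : 'cV[int]_n) : 'cV[R]_d := AR *m map_mx intr z.

Let ptB y z : pt (y - z) = pt y - pt z.
Proof. by rewrite /pt map_mxB mulmxBr. Qed.

Let omega_alpha : supported A alpha omega.
Proof.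
move=> i iI; rewrite mxE (fintype.subsetP Iab)//; exact: c_alpha.
Qed.

Let latticeP z : supported A beta z -> H (pt z).
Proof. by move=> zs; rewrite /H latticeE; exists z. Qed.

Let latticeB x y : H x -> H y -> H (x - y).
Proof.
rewrite /H latticeE => -[z zs <-] [w ws <-]; exists (z - w); last by rewrite -ptB.
by move=> i iI; rewrite !mxE zs// ws// subr0.
Qed.

Lemma omega_multiple (s : int) : H (pt (s *: omega)) <-> (g%:Z %| s)%Z.
Proof.
split.
  rewrite /H latticeE => -[w ws we].
  have : A *m (s *: omega - w) = 0.
    by apply/AR_int; rewrite -/(pt _) ptB -we subrr.
  move=> /relZ[|t tE].
    move=> i iI; rewrite !mxE (supported_beta_alpha ws)// (fintype.subsetP Iab)//.
    by rewrite c_alpha// mulr0 subrr.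
  have [r rE] := c_bezout.
  apply/dvdzP; exists t.
  rewrite -[LHS]mulr1 -[RHS]mulr1 -rE !mulr_sumr; apply: eq_bigr => i iI.
  have /colP/(_ i) := tE; rewrite !mxE ws// subr0 iI (gamma_gc iI) => e.
  transitivity (r i * (s * c i)); first by ring.
  by rewrite e; ring.
move=> /dvdzP[t ->].
have -> : pt ((t * g%:Z) *: omega) = pt ((t * g%:Z) *: omega - t *: gamma).
  rewrite ptB -[LHS]subr0; congr (_ - _).
  by rewrite /pt map_mxZ -scalemxAr; have [->] := AR_int gamma; rewrite // scaler0.
apply: latticeP => i iI; rewrite !mxE iI (gamma_gc iI); ring.
Qed.

(** The cosets are those of the multiples of [omega], counted modulo [g]. *)
Lemma face_index_gcd : face_index A alpha beta = g.
Proof.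
rewrite /face_index /subgroup_index -/H.
pose coset (x : 'cV[R]_d) : set 'cV[R]_d := [set x + h | h in H].
have cosetP x y : coset x = coset y <-> H (x - y).
  have H0 : H 0 by have := @latticeP 0; rewrite /pt map_mx0 mulmx0; apply => i _; rewrite mxE.
  have HN z : H z -> H (- z) by move=> Hz; rewrite -sub0r; exact: latticeB.
  split.
    move=> e; have : coset x x by exists 0; rewrite ?addr0.
    by rewrite e => -[h Hh <-]; rewrite addrC addKr.
  move=> Hxy; apply/seteqP; split => _ [h Hh <-].
    exists (x - y + h); last by rewrite addrA addrCA subrr addr0.
    by rewrite -[h]opprK; apply: latticeB => //; exact: HN.
  exists (h - (x - y)); first exact: latticeB.
  by rewrite opprB addrCA [x + _]addrCA subrr addr0 addrC.
apply: card_fset_set.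
have -> : [set [set (x + h)%R | h in H] | x in lattice_of A alpha `&` lin_span beta]
    = (fun r : nat => coset (pt (r%:Z *: omega))) @` `I_g.
  apply/seteqP; split => [_ [x [Lx Wx] <-]|_ [r rg <-]]; last first.
    exists (pt (r%:Z *: omega)) => //; split.
      by rewrite latticeE; exists (r%:Z *: omega) => // i iI; rewrite mxE omega_alpha// mulr0.
    apply/in_span_beta; first by move=> i iI; rewrite mxE omega_alpha// mulr0.
    by exists r%:Z => i iI; rewrite !mxE iI.
  move: Lx Wx; rewrite latticeE => -[z zs <-] /(in_span_beta zs)[s sE].
  have g0 : g%:Z != 0 by rewrite eqz_nat -lt0n gcd_gt0.
  have [r rE] : exists r : nat, r%:Z = (s %% g%:Z)%Z.
    by exists (absz (s %% g%:Z)%Z); rewrite gez0_abs// modz_ge0.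
  exists r; first by rewrite /= -ltz_nat rE ltz_mod.
  apply/cosetP; rewrite -[AR *m _]/(pt z).
  have -> : pt (r%:Z *: omega) - pt z =
      (pt ((r%:Z - s) *: omega)) - pt (z - s *: omega).
    by rewrite -!ptB; congr pt; rewrite scalerBl opprB addrA addrNK.
  apply: latticeB.
    apply/omega_multiple; rewrite rE {2}(divz_eq s g%:Z) opprD addrCA subrr addr0.
    by rewrite rpredN dvdz_mull.
  by apply: latticeP => i iI; rewrite !mxE iI sE// subrr.
apply: inj_card_eq => r s; rewrite !inE /= => rg sg /cosetP.
rewrite -ptB -scalerBl => /omega_multiple.
rewrite -eqz_mod_dvd => /eqP; rewrite !modz_small// ?ltz_nat//.
by move=> [].
Qed.

Let J := Ib :\: Ia.
Let m := #|J|.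

(** The columns on [alpha] and off [beta] are the ones that survive in the quotient;
    [P] extends by zero a vector indexed by them, and its transpose restricts. *)
Let P (T : pzSemiRingType) : 'M[T]_(n, m) := \matrix_(i, j) (i == enum_val j)%:R.

Let P_val (T : pzSemiRingType) (x : 'cV[T]_m) j : (P T *m x) (enum_val j) 0 = x j 0.
Proof.
rewrite mxE (bigD1 j)//= mxE eqxx mul1r big1 ?addr0// => l lj.
by rewrite mxE (inj_eq enum_val_inj) eq_sym (negbTE lj) mul0r.
Qed.

Let P_out (T : pzSemiRingType) (x : 'cV[T]_m) i : i \notin J -> (P T *m x) i 0 = 0.
Proof.
move=> iJ; rewrite mxE big1// => j _; rewrite mxE.
case: eqP => [iE|]; last by rewrite mul0r.
by rewrite iE enum_valP in iJ.
Qed.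

Let PT_E (T : pzSemiRingType) (z : 'cV[T]_n) j : ((P T)^T *m z) j 0 = z (enum_val j) 0.
Proof.
rewrite mxE (bigD1 (enum_val j))//= !mxE eqxx mul1r big1 ?addr0// => i ij.
by rewrite !mxE (negbTE ij) mul0r.
Qed.

Let PTK (T : pzSemiRingType) (x : 'cV[T]_m) : (P T)^T *m (P T *m x) = x.
Proof. by apply/colP => j; rewrite PT_E P_val. Qed.

Let PTmap (z : 'cV[int]_n) : (P R)^T *m map_mx intr z = map_mx intr ((P int)^T *m z).
Proof.
by apply/colP => j; rewrite PT_E !mxE -[RHS](_ : (z (enum_val j) 0)%:~R = _)// -PT_E mxE.
Qed.

Let J_off (i : 'I_n) : i \in J -> i \in Ib /\ i \notin Ia.
Proof. by move=> /finset.setDP[]. Qed.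

Let supported_P (T : pzSemiRingType) (x : 'cV[T]_m) : supported A alpha (P T *m x).
Proof. by move=> i iI; apply: P_out; rewrite finset.in_setD iI. Qed.

Let cJ : 'cV[int]_m := \col_j c (enum_val j).

Lemma cJ_bezout : exists r : 'rV[int]_m, r *m cJ = 1%:M.
Proof.
have [r rE] := c_bezout; exists (\row_j r (enum_val j)).
apply/matrixP => a b; rewrite !ord1 !mxE eqxx -rE.
rewrite [RHS](bigID (fun i => i \in Ia)) /= [X in _ = X + _]big1 ?add0r; last first.
  by move=> i /andP[_ iI]; rewrite c_alpha// mulr0.
rewrite [RHS](eq_bigl (fun i => i \in J)); last by move=> i; rewrite finset.in_setD andbC.
by rewrite [RHS]big_enum_val; apply: eq_bigr => j _; rewrite !mxE.
Qed.

Lemma in_span_beta_restrict (z : 'cV[int]_n) : supported A alpha z ->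
  lin_span beta (pt z) <-> exists s : int, (P int)^T *m z = s *: cJ.
Proof.
move=> zs; rewrite in_span_beta//; split => -[s sE]; exists s.
  by apply/colP => j; rewrite PT_E !mxE sE//; case: (J_off (enum_valP j)).
move=> i iI; have [ia|ia] := boolP (i \in Ia); first by rewrite zs// c_alpha// mulr0.
have iJ : i \in J by rewrite finset.in_setD ia.
have /colP/(_ (enum_rank_in iJ i)) := sE.
by rewrite PT_E !mxE enum_rankK_in.
Qed.

(** The quotient of the free lattice by [cJ] vanishes on every relation among the
    columns on [alpha], all of them multiples of [gamma], so it factors through
    these columns. *)
Lemma quotient_coords_exist : exists k (M : 'M[R]_(k, d)),
  quotient_coords (lattice_of A alpha) (lin_span beta) M.
Proof.
have [r rc] := cJ_bezout; have [k [N [Nc Ns Nk]]] := primitive_quotient rc.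
exists k.
pose N2 : 'M[R]_(k, n) := map_mx intr N *m (P R)^T.
(* [D] erases the coordinates off [alpha]. *)
pose D : 'M[R]_n := diag_mx (\row_i (i \notin Ia)%:R).
have DE (x : 'cV[R]_n) i : (D *m x) i 0 = if i \in Ia then 0 else x i 0.
  by rewrite mul_diag_mx !mxE; case: ifP => _ /=; rewrite ?mul0r ?mul1r.
have Ds x : supported A alpha (D *m x) by move=> i iI; rewrite DE iI.
have Did (x : 'cV[R]_n) : supported A alpha x -> D *m x = x.
  by move=> xs; apply/colP => i; rewrite DE; case: ifPn => // iI; rewrite xs.
have ND (x : 'cV[R]_n) : N2 *m x = N2 *m (D *m x).
  rewrite -!mulmxA; congr (_ *m _); apply/colP => j; rewrite !PT_E DE ifN//.
  by case: (J_off (enum_valP j)).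
have N2A : (N2 <= AR *m D)%MS.
  rewrite submxE; apply/eqP; apply/matrixP => a b; rewrite [RHS]mxE.
  set X := cokermx _; have Xb : AR *m (D *m col b X) = 0.
    by rewrite mulmxA colE mulmxA mulmx_coker mul0mx.
  have [t tE] := relR Xb (Ds _).
  have -> : (N2 *m X) a b = (N2 *m col b X) a 0.
    by rewrite [LHS]mxE [RHS]mxE; apply: eq_bigr => i _; rewrite [col _ _ _ _]mxE.
  rewrite ND tE -scalemxAr -mulmxA PTmap -map_mxM.
  have -> : (P int)^T *m gamma = g%:Z *: cJ.
    apply/colP => j; rewrite PT_E !mxE gamma_gc 1?mulrC//.
    by case: (J_off (enum_valP j)).
  by rewrite -scalemxAr Nc scaler0 map_mx0 scaler0 mxE.
pose M := N2 *m pinvmx (AR *m D).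
have Mpt z : supported A alpha z -> M *m pt z = map_mx intr (N *m ((P int)^T *m z)).
  move=> zs; transitivity (N2 *m map_mx intr z).
    rewrite /pt -[X in _ *m (_ *m X)]Did; last by move=> i iI; rewrite mxE zs.
    by rewrite [AR *m (D *m _)]mulmxA mulmxA mulmxKpV.
  by rewrite -mulmxA PTmap -map_mxM.
exists M; split.
  rewrite latticeE; apply/seteqP; split => [_ [_ [z zs <-] <-]|_ [w _ <-]].
    by exists (N *m ((P int)^T *m z)) => //; rewrite -Mpt.
  have [x xE] := Ns w; exists (pt (P int *m x)).
    by exists (P int *m x) => //; exact: supported_P.
  by rewrite Mpt ?PTK ?xE//; exact: supported_P.
rewrite latticeE => _ [z zs <-]; rewrite -/(pt z) Mpt// in_span_beta_restrict//.
rewrite -(map_mx0 (intr : int -> R)); split => [/intr_inj_mx/Nk//|[s ->]].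
by rewrite -scalemxAr Nc scaler0.
Qed.

Lemma cJ_signs : (exists j, 0 < cJ j 0) /\ (exists j, cJ j 0 < 0).
Proof.
have g0 : 0 < g%:Z by rewrite ltz_nat gcd_gt0.
have inJ i : i \in Ib -> gamma i 0 != 0 -> i \in J.
  move=> iI gi; rewrite finset.in_setD iI andbT.
  by apply: contraNN gi => ia; rewrite gamma_alpha.
split.
  have [i iI gi] := gamma_pos; have iJ := inJ i iI (lt0r_neq0 gi).
  exists (enum_rank_in iJ i); rewrite mxE enum_rankK_in//.
  by rewrite -(pmulr_lgt0 _ g0) -gamma_gc.
have [i iI gi] := gamma_neg; have iJ := inJ i iI (ltr0_neq0 gi).
exists (enum_rank_in iJ i); rewrite mxE enum_rankK_in//.
by rewrite -(pmulr_llt0 _ g0) -gamma_gc.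
Qed.

(** The coordinates entering the definition of the subdiagram volume are an
    arbitrary choice, so every choice has to be shown to produce a circuit. *)
Lemma quotient_coords_circuit k (M : 'M[R]_(k, d)) :
  quotient_coords (lattice_of A alpha) (lin_span beta) M ->
  exists E : 'M[int]_(k, m), [/\ E *m cJ = 0,
    forall w : 'cV[int]_k, exists x, E *m x = w,
    forall x : 'cV[int]_m, E *m x = 0 -> exists s : int, x = s *: cJ &
    forall z, supported A alpha z -> M *m pt z = map_mx intr (E *m ((P int)^T *m z))].
Proof.
move=> [ML MW].
have inL z : supported A alpha z -> lattice_of A alpha (pt z).
  by move=> zs; rewrite latticeE; exists z.
have Mint z : supported A alpha z -> exists w : 'cV[int]_k, M *m pt z = map_mx intr w.
  move=> zs; have : [set M *m x | x in lattice_of A alpha] (M *m pt z).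
    by exists (pt z) => //; exact: inL.
  by rewrite ML => -[w _ <-]; exists w.
have [f fE] := choice (fun j : 'I_m => Mint _ (supported_P (delta_mx j 0 : 'cV[int]_m))).
pose E := \matrix_(a, j) f j a 0.
have ME (x : 'cV[int]_m) : M *m pt (P int *m x) = map_mx intr (E *m x).
  rewrite /pt [map_mx intr (E *m x)]map_mxM (mulmx_sum_col (map_mx intr E)).
  have -> : P int *m x = \sum_j x j 0 *: (P int *m delta_mx j 0).
    by rewrite mulmx_sum_col; apply: eq_bigr => j _; rewrite colE.
  rewrite raddf_sum !mulmx_sumr; apply: eq_bigr => j _ /=.
  rewrite map_mxZ -!scalemxAr -/(pt _) fE mxE; congr (_ *: _).
  by apply/colP => a; rewrite !mxE.
have Mz z : supported A alpha z -> M *m pt z = map_mx intr (E *m ((P int)^T *m z)).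
  move=> zs; rewrite -ME; apply/eqP; rewrite -subr_eq0 -mulmxBr -ptB; apply/eqP.
  have ws : supported A alpha (z - P int *m ((P int)^T *m z)).
    by move=> i iI; rewrite [LHS]mxE zs// add0r [LHS]mxE supported_P ?oppr0.
  apply/MW; first exact: inL.
  by apply/in_span_beta_restrict => //; exists 0; rewrite mulmxBr PTK subrr scale0r.
exists E; split => //.
- apply: (@intr_inj_mx R); rewrite -ME map_mx0; apply/MW; first by apply: inL; exact: supported_P.
  by apply/in_span_beta_restrict; [exact: supported_P|exists 1; rewrite PTK scale1r].
- move=> w.
  have : range (fun z : 'cV[int]_k => map_mx intr z : 'cV[R]_k) (map_mx intr w) by exists w.
  rewrite -ML latticeE => -[_ [z zs <-]]; rewrite -/(pt z) Mz// => /intr_inj_mx zw.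
  by exists ((P int)^T *m z).
- move=> x Ex; have : lin_span beta (pt (P int *m x)).
    by apply/MW; [by apply: inL; exact: supported_P|rewrite ME Ex map_mx0].
  by move=> /in_span_beta_restrict[]; [exact: supported_P|move=> s; rewrite PTK => ->; exists s].
Qed.

Lemma subdiagram_volume_gcd : (exists i, beta (column A i)) ->
  subdiagram_volume A alpha beta =
    ((Num.min (\sum_(i in Ib | (0 : int) < gamma i 0) `|gamma i 0|)
              (\sum_(i in Ib | gamma i 0 < (0 : int)) `|gamma i 0|))%:~R / g%:R : R)%:E.
Proof.
move=> [ib ibeta]; rewrite /subdiagram_volume.
set S := [set kM | _]; have S0 : S !=set0.
  by have [k [M qM]] := quotient_coords_exist; exists (existT _ k M).
have := xgetPex (existT (fun k => 'M[R]_(k, d)) 0%N 0) S0.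
case: xget => k M qM.
have [E [Ec Es Ek ME]] := quotient_coords_circuit qM.
have [r rc] := cJ_bezout; have [cp cn] := cJ_signs.
pose ER : 'M[R]_(k, m) := map_mx intr E.
have ptd i : pt (delta_mx i 0) = column A i by rewrite /pt map_delta_mx columnE colE.
have Malpha j : alpha (column A (enum_val j)) /\ M *m column A (enum_val j) = col j ER.
  have [_ ja] := J_off (enum_valP j).
  have al : alpha (column A (enum_val j) : 'cV[R]_d) by exact/notin_indices_off.
  split=> //; rewrite -ptd ME; last exact: supported_delta.
  rewrite colE -(map_delta_mx (intr : {rmorphism int -> R})) -map_mxM; congr (map_mx _ (_ *m _)).
  by apply/colP => l; rewrite PT_E !mxE (inj_eq enum_val_inj) andbT.
have Mbeta i : i \notin Ib -> M *m column A i = 0.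
  move=> ib'; have ia : i \notin Ia by apply: contraNN ib'; exact: (fintype.subsetP Iab).
  rewrite -ptd ME; last by apply: supported_delta; exact/notin_indices_off.
  rewrite (_ : _ *m delta_mx i 0 = 0) ?mulmx0 ?map_mx0//.
  apply/colP => l; rewrite PT_E !mxE; case: eqP => //= li.
  by have [] := J_off (enum_valP l); rewrite li (negbTE ib').
have SE : [set M *m a | a in columns_on A alpha] = 0 |` range (fun j => col j ER).
  apply/seteqP; split => [_ [_ [[i _ <-] ai] <-]|_ [->|[j _ <-]]].
  - have ia : i \notin Ia by exact/notin_indices_off.
    have [iB|iB] := boolP (i \in Ib); last by left; rewrite Mbeta.
    have iJ : i \in J by rewrite finset.in_setD ia.
    right; exists (enum_rank_in iJ i) => //.
    by have [_ <-] := Malpha (enum_rank_in iJ i); rewrite enum_rankK_in.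
  - have iB : ib \notin Ib by exact/notin_indices_off.
    exists (column A ib); last by rewrite Mbeta.
    split; first by exists ib.
    by apply/notin_indices_off; apply: contraNN iB; exact: (fintype.subsetP Iab).
  - by have [al <-] := Malpha j; exists (column A (enum_val j)).
(* A single column in the span of [beta] would be the whole support of [cJ],
   which has entries of both signs. *)
have colN0 j : col j ER != 0.
  apply/negP => /eqP cj0.
  have : E *m (delta_mx j 0 : 'cV[int]_m) = 0.
    by apply: (@intr_inj_mx R); rewrite map_mxM map_delta_mx -colE map_mx0.
  move=> /Ek[s sE]; have jE l : (l == j)%:R = s * cJ l 0.
    by have /colP/(_ l) := sE; rewrite !mxE andbT.
  have s0 : s != 0.
    by apply/eqP => s0; have := jE j; rewrite eqxx s0 mul0r => /eqP; rewrite oner_eq0.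
  have [jp pp] := cp; have [jn nn] := cn.
  have onlyj l : cJ l 0 != 0 -> l = j.
    move=> cl; apply/eqP; apply: contraTT isT => lj.
    by have := jE l; rewrite (negbTE lj) => /esym/eqP; rewrite mulf_eq0 (negbTE s0) (negbTE cl).
  have jE0 := onlyj _ (lt0r_neq0 pp); have jE1 := onlyj _ (ltr0_neq0 nn).
  by move: pp nn; rewrite jE0 jE1 => h /(lt_trans h); rewrite ltxx.
have SD : (0 |` range (fun j => col j ER)) `\ 0 = range (fun j => col j ER).
  apply/seteqP; split => [x [[->|//]] []//|_ [j _ <-]]; split; first by right; exists j.
  by move=> /= /eqP; rewrite (negbTE (colN0 j)).
rewrite SE SD (volume_lattice_circuit R rc Ec Es Ek cp cn); congr EFin.
have gR : (g%:R : R) != 0 by rewrite pnatr_eq0 -lt0n gcd_gt0.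
have g0 : 0 < g%:Z by rewrite ltz_nat gcd_gt0.
have sumE (Q : pred int) : ~~ Q 0 -> (forall a, Q (a * g%:Z) = Q a) ->
    \sum_(i in Ib | Q (gamma i 0)) `|gamma i 0| =
    (\sum_(j | Q (cJ j 0)) `|cJ j 0|) * g%:Z.
  move=> Q0 Qg; rewrite (eq_bigl (fun i => (i \in J) && Q (gamma i 0))); last first.
    move=> i; rewrite finset.in_setD; have [ia|//] := boolP (i \in Ia).
    by rewrite gamma_alpha// (negbTE Q0) !andbF.
  rewrite big_enum_val_cond mulr_suml; apply: eq_big => j.
    by rewrite mxE gamma_gc ?Qg//; case: (J_off (enum_valP j)).
  move=> _; rewrite mxE gamma_gc ?normrM ?(gtr0_norm g0)//.
  by case: (J_off (enum_valP j)).
rewrite (sumE (fun a => 0 < a)) ?ltxx//; last by move=> a; rewrite pmulr_lgt0.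
rewrite (sumE (fun a => a < 0)) ?ltxx//; last by move=> a; rewrite pmulr_llt0.
by rewrite -minr_pMl ?ltW// intrM mulfK.
Qed.

End FacePair.

(** * The theorem *)

Theorem theorem3p7 (R : realType) (d : nat)
    (A : 'M[int]_(d, d.+2)) (B : 'M[int]_(d.+2, 2))
    (alpha beta : set 'cV[R]_d) (ell : set 'rV[R]_2) (v : 'rV[int]_2) :
  \rank (map_mx intr A : 'M[rat]_(d, d.+2)) = d ->
  ((const_mx 1 : 'rV[rat]_(d.+2)) <= (map_mx intr A : 'M[rat]_(d, d.+2)))%MS ->
  gale_dual A B ->
  (forall i, row i B != 0) ->
  is_proper_face (polytope A) alpha ->
  is_proper_face (polytope A) beta ->
  beta `<=` alpha ->
  ~ (exists l : set 'rV[R]_2,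
       relevant_line B l /\ rows_in B (indices_off A beta) l) ->
  relevant_line B ell ->
  rows_in B (indices_off A alpha) ell ->
  ell (map_mx intr v) ->
  primitive_vector v ->
  let gamma := gale_det v B in
  let I := indices_off A beta in
  let g := \big[gcdn/0%N]_(i in I) `|gamma i|%N in
  subdiagram_volume A alpha beta =
    ((Num.min (\sum_(i in I | (0 : int) < gamma i) `|gamma i|)
              (\sum_(i in I | gamma i < (0 : int)) `|gamma i|))%:~R / g%:R : R)%:E
  /\ face_index A alpha beta = g.
Proof.
move=> _ one AB b0 [fa aP] [fb bP] ba notline rel Ia_ell ellv pv gamma I g.
have [[u u0 ellE] _] := rel.
have [ua [ca fua]] := faceP fa; have [ub [cb fub]] := faceP fb.
have [i0 i0a] := proper_face_off fua aP.
have [cv vE] : exists cv, map_mx intr v = cv *: u.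
  by move: ellv; rewrite ellE => -[cv _ <-]; exists cv.
have det0 i : ell (gale_row B i) -> gale_det v B i = 0.
  rewrite ellE => -[cb' _ bE]; apply: (@intr_inj R).
  rewrite gale_detE mxE !big_ord_recl big_ord0 addr0 rmorphD !rmorphM rmorph0 /= !mxE /= rmorphN /=.
  have vj j : (v 0 j)%:~R = cv * u 0 j by move/rowP: vE => /(_ j); rewrite !mxE.
  have bj j : (B i j)%:~R = cb' * u 0 j by move/rowP: bE => /(_ j); rewrite !mxE => ->.
  by rewrite (_ : lift _ _ = 1) ?vj ?bj; [ring|exact/val_inj].
have i0_det : gale_det v B i0 = 0 by apply/det0/Ia_ell.
pose z := B *m orth v.
have zE i : z i 0 = gale_det v B i by rewrite gale_detE.
have Az : A *m z = 0 by exact: gamma_relation.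
have Iab : indices_off A alpha \subset indices_off A beta.
  apply/fintype.subsetP => i; rewrite !in_indices_off; apply: contraNN.
  by rewrite !inE => /ba.
have znz : exists2 i, i \in indices_off A beta & z i 0 != 0.
  apply: contrapT => nz; apply: notline; exists ell; split => //.
  move=> i iI; have gi : gale_det v B i = 0.
    by rewrite -zE; apply/eqP; apply: contrapT => /negP zi; apply: nz; exists i.
  have [s [_ bE]] := row_on_line pv (b0 i) gi.
  rewrite ellE; exists (s%:~R * cv) => //.
  by rewrite -scalerA -vE /gale_row bE map_mxZ.
have zpos := face_relation_signs Az one fub znz.
have zneg : exists2 i, i \in indices_off A beta & z i 0 < 0.
  have Anz : A *m (- z) = 0 by rewrite mulmxN Az oppr0.
  have [|i iI] := face_relation_signs Anz one fub.
    by have [i iI zi] := znz; exists i => //; rewrite mxE oppr_eq0.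
  by rewrite mxE oppr_gt0 => zi; exists i.
have zsupp : supported A alpha z by move=> i iI; rewrite zE; apply/det0/Ia_ell.
have relR (x : 'cV[R]_d.+2) : map_mx intr A *m x = 0 -> supported A alpha x ->
    exists t : R, x = t *: map_mx intr z.
  by move=> Ax xs; apply: (real_relation AB pv (b0 i0) i0_det Ax); exact: xs.
have relZ (x : 'cV[int]_d.+2) : A *m x = 0 -> supported A alpha x ->
    exists t : int, x = t *: z.
  by move=> Ax xs; apply: (int_relation AB pv (b0 i0) i0_det Ax); exact: xs.
have spanb := lin_span_face fub.
have gE : gamma = fun i => z i 0 by apply/funext => i; rewrite zE.
rewrite /g /I gE; split.
  have bcol := face_nonempty fub fb.1.
  exact: (subdiagram_volume_gcd Iab zsupp Az relR zpos zneg spanb bcol).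
exact: (face_index_gcd Iab zsupp Az relR relZ zpos spanb).
Qed.
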